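(* Let $G$ be any probability measure on $[0,\infty)$. Then there exists a convex, deterministic function $\Lambda:[0,\infty)\to[0,\infty)$, depending on $G$, such that for every $v\ge 0$, \[\Lambda(v)=\lim_{n\to\infty}\frac1n T((0,0),(n,\lceil vn\rceil))\] almost surely and in $L^1$.
   Context: Model: Let $G$ be a probability measure on $[0,\infty)$. In the nearest-neighbour lattice $\mathbb Z^2$, every vertical edge (joining $(x,y)$ and $(x,y+1)$) receives the deterministic weight $\tau_e=1$, and every horizontal edge (joining $(x,y)$ and $(x+1,y)$) receives a random weight $\tau_e$, the horizontal weights being independent with law $G$. A path is a sequence $p=(z_0,z_1,\dots)$ of points of $\mathbb Z^2$ with $z_k,z_{k+1}$ joined by an edge; an edge $e$ lies in $p$ if $e=(z_k,z_{k+1})$ for some $k$. The passage time is $T(p)=\sum_{e\in p}\tau_e$, and for $u,w\in\mathbb Z^2$, $T(u,w)=\inf_p T(p)$ over all paths from $u$ to $w$. $\lceil a\rceil$ is the smallest integer $\ge a$. *)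

(* Defs.v *)
From HB Require Import structures.
From mathcomp Require Import all_boot all_order all_algebra.
From mathcomp Require Import all_classical all_reals all_analysis.
Set Implicit Arguments. Unset Strict Implicit. Unset Printing Implicit Defensive.
Import Order.TTheory GRing.Theory Num.Theory.
Local Open Scope classical_set_scope.
Local Open Scope ring_scope.

Definition pt := (int * int)%type.

Definition adj (a b : pt) : bool :=
  ((a.2 == b.2) && ((b.1 == a.1 + 1) || (a.1 == b.1 + 1))) ||
  ((a.1 == b.1) && ((b.2 == a.2 + 1) || (a.2 == b.2 + 1))).

Section FPP.
Variable R : realType.

(* [hw (x,y)] is the weight of the horizontal edge joining (x,y) and (x+1,y).
   Vertical edges have weight 1. For adjacent a b, [edge_weight hw a b] is
   the weight of the edge {a,b}. *)
Definition edge_weight (hw : pt -> R) (a b : pt) : R :=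
  if a.2 == b.2 then hw (Order.min a.1 b.1, a.2) else 1.

Definition is_path_from_to (u w : pt) (p : seq pt) : Prop :=
  path adj u p /\ last u p = w.

Definition path_time (hw : pt -> R) (u : pt) (p : seq pt) : R :=
  \sum_(t <- pairmap (edge_weight hw) u p) t.

Definition passage_time (hw : pt -> R) (u w : pt) : R :=
  inf [set path_time hw u p | p in [set p | is_path_from_to u w p]].

Definition mutually_independent {d} {Omega : measurableType d}
  (P : probability Omega R) {I : eqType} (X : I -> Omega -> R) : Prop :=
  forall (s : seq I) (A : I -> set R), uniq s ->
    (forall i, measurable (A i)) ->
    P (\bigcap_(i in [set` s]) (X i @^-1` A i)) =
    (\prod_(i <- s) P (X i @^-1` A i))%E.

Definition convex_on_nonneg (L : R -> R) : Prop :=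
  forall a b t : R, 0 <= a -> 0 <= b -> 0 <= t <= 1 ->
    L (t * a + (1 - t) * b) <= t * L a + (1 - t) * L b.

End FPP.

(* Main.v *)
Require Import Defs.
From HB Require Import structures.
From mathcomp Require Import all_boot all_order all_algebra.
From mathcomp Require Import all_classical all_reals all_analysis.
From mathcomp Require Import measurable_realfun zify ring lra.
Import Order.TTheory GRing.Theory Num.Theory.
Import numFieldNormedType.Exports.
Local Open Scope classical_set_scope.
Local Open Scope ring_scope.

(** Since vertical edges cost 1, a column is crossed at cost at most
    [min_j (2 j + tau_j)], which is integrable whatever the law [G] is. Hence the
    expected passage times are finite and, up to the rounding of heights, subadditive,
    so that their rate of growth [Lambda v] exists; concatenation gives convexity.

    The almost sure statements come from a one-sided ergodic theorem: a superadditive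
    process [v i j] that dominates, up to a constant, the translates of [v 0 n] cannot
    outgrow its mean. Changing one edge changes [v 0 n] by a bounded amount, so by the
    zero-one law [v 0 n <= c n + O(1)] has probability 0 or 1. If it had probability 0,
    then from most sites there would be a jump of bounded length gaining [c] per unit,
    and chaining such jumps greedily would make the mean grow at rate [c]. With minus
    the passage times as process this is the lower bound. For the upper bound it is
    applied to sums of the passage times of consecutive blocks, computed in strips so
    that each edge affects only finitely many blocks.

    Convergence in L^1 follows because the means converge and the negative part of
    [T n / n - Lambda v] is bounded.

    The proof is carried out on the space of environments [pt -> R] with its cylinder
    sigma-algebra; all models induce there the same law. *)

Set Implicit Arguments. Unset Strict Implicit. Unset Printing Implicit Defensive.

(** * Linear growth of real sequences *)

Section LinearGrowth.
Variable R : realType.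
Implicit Types (u : nat -> R) (b c e : R).

Definition le_line u c := exists b, forall n, u n <= c * n%:R + b.

(* [rate_le u c] says that [limsup u n / n <= c]. *)
Definition rate_le u c := forall e, 0 < e -> le_line u (c + e).

Lemma archimedean_mulr b e : 0 < e -> exists n : nat, b < e * n%:R.
Proof.
move=> e_gt0; exists (Num.truncn (b / e)).+1.
by rewrite mulrC -ltr_pdivrMr// truncnS_gt.
Qed.

Lemma exists_invS_le e : 0 < e -> exists n : nat, n.+1%:R^-1 <= e.
Proof.
move=> e_gt0; exists (Num.truncn e^-1).
by rewrite invf_ple ?posrE// ltW// truncnS_gt.
Qed.

Lemma le_line_le_addr u v b c :
  (forall n, v n <= u n + b) -> le_line u c -> le_line v c.
Proof.
move=> vu [b' ub']; exists (b' + b) => n.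
by rewrite addrA; apply: le_trans (vu n) _; rewrite lerD2r.
Qed.

Lemma le_line_slope u c c' : c <= c' -> le_line u c -> le_line u c'.
Proof.
move=> cc' [b ub]; exists b => n; apply: le_trans (ub n) _.
by rewrite lerD2r ler_wpM2r.
Qed.

Lemma rate_leP u c :
  rate_le u c <-> forall j : nat, le_line u (c + j.+1%:R^-1).
Proof.
split=> [uc j|uc e /exists_invS_le[j je]]; first by apply: uc; rewrite invr_gt0.
by apply: le_line_slope (uc j); rewrite lerD2l.
Qed.

Lemma le_of_linear x y b : (forall n : nat, x * n%:R <= y * n%:R + b) -> x <= y.
Proof.
move=> xy; rewrite leNgt; apply/negP; rewrite -subr_gt0.
move=> /(archimedean_mulr b)[n]; have := xy n; rewrite mulrBl; lra.
Qed.

Lemma rate_cvg u c : rate_le u c -> rate_le (fun n => - u n) (- c) ->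
  (fun n => u n / n%:R) @ \oo --> c.
Proof.
move=> rate_u rate_Nu; apply/cvgrPdist_le => e e_gt0.
have e2_gt0 : 0 < e / 2 by rewrite divr_gt0.
have [[b ub] [b' Nub]] := (rate_u _ e2_gt0, rate_Nu _ e2_gt0).
have [n0 bn0] := archimedean_mulr (Num.max b b') e2_gt0.
exists n0.+1 => // n /= n0n.
have n_gt0 : 0 < n%:R :> R by rewrite ltr0n; lia.
have : Num.max b b' < e / 2 * n%:R.
  by apply: lt_le_trans bn0 _; rewrite ler_pM2l// ler_nat ltnW.
rewrite gt_max => /andP[bn b'n].
have [un Nun] := (ub n, Nub n).
rewrite distrC ler_distl ler_pdivlMr// ler_pdivrMr//; apply/andP; split; lra.
Qed.

Lemma subadditive_slope_le u k n : (forall n, 0 <= u n) ->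
  (forall n m, u (n + m)%N <= u n + u m) -> (0 < k)%N ->
  u n <= u k / k%:R * n%:R + \sum_(r < k) u r.
Proof.
move=> u_ge0 sub k_gt0.
have u_mult p r : (r < k)%N -> u (p * k + r)%N <= p%:R * u k + \sum_(r < k) u r.
  move=> rk; elim: p => [|p ih].
    by rewrite mul0r add0r (bigD1 (Ordinal rk))//= lerDl sumr_ge0.
  rewrite mulSn -addnA; apply: le_trans (sub _ _) _.
  by rewrite -natr1 mulrDl mul1r addrAC [leLHS]addrC lerD2r.
rewrite {1}(divn_eq n k); apply: le_trans (u_mult _ _ (ltn_pmod n k_gt0)) _.
rewrite lerD2r mulrC -mulrA ler_wpM2l// mulrC ler_pdivlMr ?ltr0n//.
by rewrite -natrM ler_nat leq_divM.
Qed.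

Lemma fekete_rate_le u : (forall n, 0 <= u n) ->
  (forall n m, u (n + m)%N <= u n + u m) ->
  rate_le u (inf [set u k / k%:R | k in [set k | (0 < k)%N]]).
Proof.
move=> u_ge0 sub e e_gt0; set S := image _ _.
have [_ [k k_gt0 <-] slope_lt] : exists2 x, S x & x < inf S + e.
  by apply: inf_lt; [exists (u 1%N / 1), 1%N|rewrite ltrDl].
exists (\sum_(r < k) u r) => n.
apply: le_trans (subadditive_slope_le n u_ge0 sub k_gt0) _.
by rewrite lerD2r ler_wpM2r// ltW.
Qed.

(* From a good index jump ahead over a block of value at least [c] per unit;
   from a bad one, or within [N] of the end, advance by one. *)
Lemma greedy_chain (v : nat -> nat -> R) (D : nat -> R) (bad : pred nat) c (N m : nat) :
  (forall i j k, (i <= j <= k)%N -> v i j + v j k <= v i k) ->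
  (forall i, 0 <= v i i) -> (forall i, 0 <= D i) ->
  (forall i, c - D i <= v i i.+1) ->
  (forall i, ~~ bad i -> exists2 n, (0 < n <= N)%N & c * n%:R <= v i (i + n)%N) ->
  c * m%:R <= v 0%N m + \sum_(i < m) ((bad i)%:R + (m < i + N)%N%:R) * D i.
Proof.
move=> super v_diag D_ge0 step jump.
pose penalty i := ((bad i)%:R + (m < i + N)%N%:R) * D i.
have penalty_ge0 i : 0 <= penalty i by rewrite mulr_ge0.
suff chain k i : (i + k = m)%N -> c * k%:R <= v i m + \sum_(i <= j < m) penalty j.
  by have := chain m 0%N (add0n m); rewrite big_mkord.
elim/ltn_ind: k i => k ih i ikm; have [k0|k_gt0] := posnP k.
  by rewrite k0 mulr0 addr_ge0 ?sumr_ge0// (_ : i = m) //; lia.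
have [bad_i|] := boolP (bad i || (m < i + N)%N).
  have tail : c * k.-1%:R <= v i.+1 m + \sum_(i.+1 <= j < m) penalty j by apply: ih; lia.
  have concat : v i i.+1 + v i.+1 m <= v i m by apply: super; lia.
  have Di_le : D i <= penalty i.
    by rewrite ler_peMl// -natrD ler1n; move: bad_i; case: (bad i); lia.
  have -> : k%:R = 1 + k.-1%:R :> R by rewrite nat1r prednK.
  by rewrite big_ltn; [have := step i; lra|lia].
rewrite negb_or -leqNgt => /andP[/jump[n n_bounds jump_n] iN].
have tail : c * (k - n)%N%:R <= v (i + n)%N m + \sum_(i + n <= j < m) penalty j by apply: ih; lia.
have concat : v i (i + n)%N + v (i + n)%N m <= v i m by apply: super; lia.
have skipped : 0 <= \sum_(i <= j < i + n) penalty j by rewrite sumr_ge0.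
have -> : k%:R = n%:R + (k - n)%N%:R :> R by rewrite -natrD subnKC//; lia.
by rewrite (@big_cat_nat _ _ _ (i + n)%N); [rewrite /= mulrDr; lra|lia|lia].
Qed.

Lemma sum_near_end_le (m N : nat) : \sum_(i < m) (m < i + N)%N%:R <= N%:R :> R.
Proof.
rewrite -natr_sum ler_nat.
suff : forall k, (\sum_(i < k) (m < i + N) <= k + N - m)%N by move/(_ m); rewrite addKn.
elim=> [|k ih]; first by rewrite big_ord0.
by rewrite big_ord_recr /=; apply: leq_trans (leq_add ih (leqnn _)) _; case: ltnP; lia.
Qed.

End LinearGrowth.

(** * Passage times restricted to an interval of columns *)

Local Notation plane := (`]-oo, +oo[ : interval int).

Section RestrictedTime.
Variable R : realType.
Implicit Types (I J : interval int) (hw : pt -> R) (u v w z e : pt) (p : seq pt).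

Definition path_in I u w p :=
  [/\ path adj u p, last u p = w & all (fun z : pt => z.1 \in I) (u :: p)].

Definition restricted_time I hw u w : R :=
  inf [set path_time hw u p | p in path_in I u w].

Definition reaches I hw u w (c : R) :=
  exists2 p, path_in I u w p & path_time hw u p <= c.

Lemma mem_interval_between I (x y z : int) :
  x \in I -> z \in I -> x <= y <= z -> y \in I.
Proof. by move=> xI zI; exact: (@interval_is_interval _ I x z xI zI y). Qed.

Lemma path_time_nil hw u : path_time hw u [::] = 0.
Proof. by rewrite /path_time /= big_nil. Qed.

Lemma path_time_cons hw u z p :
  path_time hw u (z :: p) = edge_weight hw u z + path_time hw z p.
Proof. by rewrite /path_time /= big_cons. Qed.

Lemma path_time_cat hw u p q :
  path_time hw u (p ++ q) = path_time hw u p + path_time hw (last u p) q.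
Proof. by rewrite /path_time pairmap_cat big_cat. Qed.

Lemma adj_sym u w : adj u w = adj w u.
Proof. by rewrite /adj; lia. Qed.

Lemma edge_weight_sym hw u w : edge_weight hw u w = edge_weight hw w u.
Proof. by rewrite /edge_weight eq_sym minC; case: eqP => // ->. Qed.

Lemma path_in_cons I u w z p :
  path_in I u w (z :: p) <-> [/\ adj u z, u.1 \in I & path_in I z w p].
Proof.
rewrite /path_in /=; split.
  by case=> /andP[-> ->] -> /andP[-> ->].
by case=> -> -> [-> -> ->].
Qed.

Lemma reaches_refl I hw u : u.1 \in I -> reaches I hw u u 0.
Proof. by move=> uI; exists [::]; rewrite ?path_time_nil//; split; rewrite //= uI. Qed.

Lemma reaches_trans I hw u v w c c' :
  reaches I hw u v c -> reaches I hw v w c' -> reaches I hw u w (c + c').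
Proof.
move=> [p [adj_p last_p in_p] cost_p] [q [adj_q last_q in_q] cost_q].
exists (p ++ q); last by rewrite path_time_cat last_p lerD.
split; first by rewrite cat_path adj_p last_p.
- by rewrite last_cat last_p.
- by rewrite -cat_cons all_cat in_p; case/andP: in_q.
Qed.

Lemma reaches_adj I hw u w : adj u w -> u.1 \in I -> w.1 \in I ->
  reaches I hw u w (edge_weight hw u w).
Proof.
move=> uw uI wI; exists [:: w]; last by rewrite path_time_cons path_time_nil addr0.
by apply/path_in_cons; split; rewrite // /path_in /= wI.
Qed.

Lemma reaches_sym I hw u w c : reaches I hw u w c -> reaches I hw w u c.
Proof.
move=> [p]; elim: p u c => [|z p ih] u c.
  by move=> [_ /= <-] /andP[uI _]; exists [::] => //; split; rewrite //= uI.
move=> /path_in_cons[uz uI zp]; rewrite path_time_cons => cost.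
have zI : z.1 \in I by case: zp => _ _ /andP[].
have [|q wq cost_q] := reaches_trans (ih z (path_time hw z p) zp (lexx _))
  (reaches_adj hw _ zI uI); first by rewrite adj_sym.
by exists q => //; rewrite (le_trans cost_q)// addrC edge_weight_sym.
Qed.

Lemma reaches_vert I hw (x y y' : int) :
  x \in I -> reaches I hw (x, y) (x, y') (`|y' - y|%:~R).
Proof.
move=> xI; wlog : y y' / y <= y' => [upwards|yy'].
  by case/orP: (le_total y y') => /upwards// /reaches_sym; rewrite distrC.
have {yy'}[n ->] : exists n : nat, y' = y + n%:Z by exists `|y' - y|%N; lia.
rewrite addrAC subrr add0r ger0_norm// -[_%:~R]/(n%:R).
elim: n => [|n ih]; first by rewrite addr0; exact: reaches_refl.
rewrite -natr1; apply: reaches_trans ih _.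
rewrite [X in reaches _ _ _ _ X](_ : _ = edge_weight hw (x, y + n%:Z) (x, y + n.+1%:Z)).
  by apply: reaches_adj => //; rewrite /adj /=; lia.
by rewrite /edge_weight ifF//=; lia.
Qed.

Lemma reaches_horiz I hw (x y : int) : x \in I -> x + 1 \in I ->
  reaches I hw (x, y) (x + 1, y) (hw (x, y)).
Proof.
move=> xI x1I.
rewrite [X in reaches _ _ _ _ X](_ : _ = edge_weight hw (x, y) (x + 1, y)).
  by apply: reaches_adj => //; rewrite /adj /=; lia.
by rewrite /edge_weight /= eqxx min_l//; lia.
Qed.

Lemma reaches_any I hw u w : u.1 \in I -> w.1 \in I -> exists c, reaches I hw u w c.
Proof.
case: u w => [x y] [x' y'] /=; wlog : x x' y y' / x <= x' => [rightwards|xx'] xI x'I.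
  case/orP: (le_total x x') => [|x'x]; first by move/rightwards; exact.
  by have [c /reaches_sym] := rightwards _ _ y' y x'x x'I xI; exists c.
have {xx'}[n ex'] : exists n : nat, x' = x + n%:Z by exists `|x' - x|%N; lia.
subst x'; elim: n y' x'I => [|n ih] y' x'I.
  by rewrite addr0; eexists; exact: reaches_vert.
have xnI : x + n%:Z \in I by apply: mem_interval_between xI x'I _; lia.
have [c reach_xn] := ih y' xnI; eexists; apply: reaches_trans reach_xn _.
have -> : x + n.+1%:Z = x + n%:Z + 1 by lia.
by apply: reaches_horiz => //; rewrite (_ : _ + 1 = x + n.+1%:Z)//; lia.
Qed.

Lemma passage_timeE hw u w : passage_time hw u w = restricted_time plane hw u w.
Proof.
congr (inf _); apply/seteqP; split => t [p].
  by move=> [adj_p last_p] <-; exists p => //; split=> //; apply/allP.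
by move=> [adj_p last_p _] <-; exists p.
Qed.

Lemma path_in_strip I u w p : path_in I u w p -> exists n0 : nat,
  forall n, (n0 <= n)%N -> path_in `[u.1 - n%:Z, w.1 + n%:Z] u w p.
Proof.
move=> [adj_p last_p _].
suff [n0 p_strip] : exists n0 : nat, forall n, (n0 <= n)%N ->
    all (fun z : pt => z.1 \in `[u.1 - n%:Z, w.1 + n%:Z]) (u :: p).
  by exists n0 => n /p_strip.
elim: (u :: p) => [|z s [n0 s_strip]]; first by exists 0%N.
exists (maxn n0 (absz (z.1 - u.1) + absz (z.1 - w.1))) => n.
by rewrite geq_max => /andP[/s_strip /= -> z_le]; rewrite in_itv /=; lia.
Qed.

Section NonnegativeWeights.
Variable hw : pt -> R.
Hypothesis hw_ge0 : forall e, 0 <= hw e.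

Lemma edge_weight_ge0 u w : 0 <= edge_weight hw u w.
Proof. by rewrite /edge_weight; case: ifP. Qed.

Lemma path_time_ge0 u p : 0 <= path_time hw u p.
Proof.
elim: p u => [|z p ih] u; first by rewrite path_time_nil.
by rewrite path_time_cons addr_ge0 ?edge_weight_ge0.
Qed.

Lemma restricted_time_ge0 I u w : 0 <= restricted_time I hw u w.
Proof.
rewrite /restricted_time; set times := image _ _.
have [->|/set0P times_neq0] := eqVneq times set0; first by rewrite inf0.
by apply: lb_le_inf => // _ [p _ <-]; exact: path_time_ge0.
Qed.

Lemma restricted_time_le I u w c : reaches I hw u w c -> restricted_time I hw u w <= c.
Proof.
move=> [p pI]; apply: le_trans; apply: ge_inf; last by exists p.
by exists 0 => _ [q _ <-]; exact: path_time_ge0.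
Qed.

Lemma restricted_time_near I u w eps : u.1 \in I -> w.1 \in I -> 0 < eps ->
  reaches I hw u w (restricted_time I hw u w + eps).
Proof.
move=> uI wI eps_gt0; have [_ [p0 p0I _]] := reaches_any hw uI wI.
have [|_ [p pI <-] /ltW cost_p] := @inf_adherent _
  [set path_time hw u p | p in path_in I u w] _ eps_gt0; last by exists p.
split; first by exists (path_time hw u p0), p0.
by exists 0 => _ [q _ <-]; exact: path_time_ge0.
Qed.

Lemma restricted_time_triangle I v u w : u.1 \in I -> v.1 \in I -> w.1 \in I ->
  restricted_time I hw u w <= restricted_time I hw u v + restricted_time I hw v w.
Proof.
move=> uI vI wI; apply/ler_addgt0Pr => eps eps_gt0.
have eps2_gt0 : 0 < eps / 2 by rewrite divr_gt0.
rewrite [X in _ + X]splitr addrACA; apply: restricted_time_le.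
by apply: reaches_trans; exact: restricted_time_near.
Qed.

Lemma restricted_time_sub I J u w : {subset I <= J} -> u.1 \in I -> w.1 \in I ->
  restricted_time J hw u w <= restricted_time I hw u w.
Proof.
move=> IJ uI wI; apply/ler_addgt0Pr => eps eps_gt0.
have [p [adj_p last_p in_p] cost_p] := restricted_time_near uI wI eps_gt0.
apply: restricted_time_le; exists p => //; split=> //.
by apply: sub_all in_p => z; exact: IJ.
Qed.

Lemma restricted_time_vert I (x y y' : int) : x \in I ->
  restricted_time I hw (x, y) (x, y') <= `|y' - y|%:~R.
Proof. by move=> xI; apply: restricted_time_le; exact: reaches_vert. Qed.

End NonnegativeWeights.

Lemma path_time_le hw hw' u p :
  (forall e, hw e <= hw' e) -> path_time hw u p <= path_time hw' u p.
Proof.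
move=> hw_le; elim: p u => [|z p ih] u; first by rewrite !path_time_nil.
by rewrite !path_time_cons lerD// /edge_weight; case: ifP.
Qed.

Lemma restricted_time_le_weights I hw hw' u w : (forall e, 0 <= hw e) ->
  (forall e, hw e <= hw' e) -> u.1 \in I -> w.1 \in I ->
  restricted_time I hw u w <= restricted_time I hw' u w.
Proof.
move=> hw_ge0 hw_le uI wI; apply/ler_addgt0Pr => eps eps_gt0.
have hw'_ge0 e : 0 <= hw' e by exact: le_trans (hw_ge0 e) (hw_le e).
have [p pI cost_p] := restricted_time_near hw'_ge0 uI wI eps_gt0.
apply: restricted_time_le => //; exists p => //.
by apply: le_trans cost_p; exact: path_time_le.
Qed.

Lemma edge_weight_local I hw hw' u w :
  (forall e, e.1 \in I -> hw e = hw' e) -> u.1 \in I -> w.1 \in I ->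
  edge_weight hw u w = edge_weight hw' u w.
Proof.
move=> hw_eq uI wI; rewrite /edge_weight; case: ifP => // _; apply: hw_eq.
by rewrite /= minEle; case: ifP.
Qed.

Lemma path_time_local I hw hw' u w p :
  (forall e, e.1 \in I -> hw e = hw' e) -> path_in I u w p ->
  path_time hw u p = path_time hw' u p.
Proof.
move=> hw_eq; elim: p u => [|z p ih] u; first by rewrite !path_time_nil.
move=> /path_in_cons[_ uI zp]; rewrite !path_time_cons (ih _ zp).
congr (_ + _); apply: edge_weight_local hw_eq uI _.
by case: zp => _ _ /andP[].
Qed.

Lemma restricted_time_local I hw hw' u w : (forall e, e.1 \in I -> hw e = hw' e) ->
  restricted_time I hw u w = restricted_time I hw' u w.
Proof.
move=> hw_eq; congr inf; apply: eq_imagel => p pI; exact: path_time_local hw_eq pI.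
Qed.

Lemma path_time_shift hw u z p :
  path_time (fun e => hw (e + z)) u p = path_time hw (u + z) [seq v + z | v <- p].
Proof.
elim: p u => [|v p ih] u; first by rewrite !path_time_nil.
rewrite /= !path_time_cons ih; congr (_ + _).
rewrite /edge_weight /= (inj_eq (addIr _)); case: ifP => // _; congr hw.
by rewrite -addr_minl.
Qed.

Lemma path_in_shift I J u w z p : (forall x, (x + z.1 \in J) = (x \in I)) ->
  path_in J (u + z) (w + z) [seq v + z | v <- p] <-> path_in I u w p.
Proof.
move=> IJ; elim: p u => [|v p ih] u /=.
  rewrite /path_in /= IJ; split=> -[_ uw uI]; split=> //; last by rewrite uw.
  exact: addIr uw.
have adj_shift : adj (u + z) (v + z) = adj u v by rewrite /adj /=; lia.
by rewrite !path_in_cons adj_shift IJ; split => -[? ? /ih].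
Qed.

Lemma restricted_time_shift I J hw u w z : (forall x, (x + z.1 \in J) = (x \in I)) ->
  restricted_time I (fun e => hw (e + z)) u w = restricted_time J hw (u + z) (w + z).
Proof.
move=> IJ; congr inf; apply/seteqP; split => _ [p pI <-].
  by exists [seq v + z | v <- p]; [apply/path_in_shift|rewrite path_time_shift].
have {}pI : path_in J (u + z) (w + z) [seq v + z | v <- [seq v - z | v <- p]].
  by rewrite mapK// => v; exact: subrK.
exists [seq v - z | v <- p]; first exact/(path_in_shift _ _ _ IJ).
by rewrite path_time_shift mapK// => v; exact: subrK.
Qed.

Definition zero_edge e hw : pt -> R := fun e' => if e' == e then 0 else hw e'.

Lemma restricted_time_zero_edge_out I hw e u w : e.1 \notin I ->
  restricted_time I (zero_edge e hw) u w = restricted_time I hw u w.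
Proof.
move=> eI; apply: restricted_time_local => e' e'I; rewrite /zero_edge.
by case: eqVneq e'I eI => // -> ->.
Qed.

Lemma edge_weight_zero_edge hw e u w : adj u w ->
  edge_weight (zero_edge e hw) u w = edge_weight hw u w \/
  [/\ edge_weight (zero_edge e hw) u w = 0, edge_weight hw u w = hw e &
      (u, w) = (e, (e.1 + 1, e.2)) \/ (u, w) = ((e.1 + 1, e.2), e)].
Proof.
case: u w => [x y] [x' y'] uw; rewrite /edge_weight /zero_edge /=.
case: eqVneq => [y_eq|]; last by left.
case: eqVneq => [<-|]; last by left.
right; split => //; rewrite -{}y_eq /= in uw *.
have [xx'|x'x] : x' = x + 1 \/ x = x' + 1 by move: uw; rewrite /adj /=; lia.
  by left; rewrite xx' min_l//; lia.
by right; rewrite x'x min_r//; lia.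
Qed.

(* Only the last crossing of [e] matters: the part of the path after it bounds the
   distance from the nearer endpoint of [e] to [w]. *)
Lemma restricted_time_zero_edge_path I hw e u w p : (forall e', 0 <= hw e') ->
  path_in I u w p -> restricted_time I hw u w <= path_time (zero_edge e hw) u p + hw e.
Proof.
move=> hw_ge0; pose dist v := restricted_time I hw v w.
pose dist_e := Num.min (dist e) (dist (e.1 + 1, e.2)).
suff last_use : path_in I u w p -> dist u <= path_time (zero_edge e hw) u p \/
    dist_e <= path_time (zero_edge e hw) u p /\
    dist u <= path_time (zero_edge e hw) u p + hw e.
  by have := hw_ge0 e; move=> + /last_use[|[]]; rewrite /dist; lra.
elim: p u => [|z p ih] u.
  move=> [_ /= ->] /andP[wI _]; left; rewrite path_time_nil.
  by apply: restricted_time_le => //; exact: reaches_refl.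
move=> /path_in_cons[uz uI zp]; rewrite path_time_cons.
have [zI wI] : z.1 \in I /\ w.1 \in I.
  case: (zp) => _ <- /allP all_in; split; apply: all_in; first exact: mem_head.
  exact: mem_last.
have dist_step : dist u <= edge_weight hw u z + dist z.
  apply: le_trans (restricted_time_triangle hw_ge0 uI zI wI) _.
  by rewrite lerD2r restricted_time_le//; exact: reaches_adj.
have weight_ge0 := edge_weight_ge0 hw_ge0 u z.
have [->|[-> weight_e ends]] := edge_weight_zero_edge hw e uz.
  by case: (ih _ zp) => [|[]] *; [left|right; split]; lra.
rewrite add0r; right.
have dist_e_le : dist_e <= dist z by case: ends => -[_ ->]; rewrite ge_min lexx ?orbT.
have dist_u_le : dist u <= dist_e + hw e.
  have : dist_e = dist u \/ dist_e = dist z.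
    by rewrite /dist_e minEle; case: ends => -[-> ->]; case: ifP; auto.
  by have := hw_ge0 e; rewrite weight_e in dist_step; case; lra.
by case: (ih _ zp) => [|[]] *; split; lra.
Qed.

Lemma restricted_time_zero_edge I hw e u w : (forall e', 0 <= hw e') ->
  u.1 \in I -> w.1 \in I ->
  `|restricted_time I hw u w - restricted_time I (zero_edge e hw) u w| <= hw e.
Proof.
move=> hw_ge0 uI wI.
have zero_ge0 e' : 0 <= zero_edge e hw e' by rewrite /zero_edge; case: ifP.
have zero_le e' : zero_edge e hw e' <= hw e' by rewrite /zero_edge; case: ifP.
rewrite ger0_norm ?subr_ge0 ?restricted_time_le_weights// lerBlDl addrC.
apply/ler_addgt0Pr => eps eps_gt0.
have [p pI cost_p] := restricted_time_near zero_ge0 uI wI eps_gt0.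
by have := restricted_time_zero_edge_path e hw_ge0 pI; lra.
Qed.

End RestrictedTime.

(** * Random environments *)

Section Environments.
Variable R : realType.
Implicit Types (s t : seq pt) (A : pt -> set R) (e z : pt).

Definition cylinder s A : set (pt -> R) := [set f | forall e, e \in s -> A e (f e)].

Definition cylinders : set (set (pt -> R)) :=
  [set C | exists s A, (forall e, measurable (A e)) /\ C = cylinder s A].

Definition env := g_sigma_algebraType cylinders.

Implicit Type f : env.

Lemma cylinder_undup s A : cylinder (undup s) A = cylinder s A.
Proof. by apply/seteqP; split => f fA e es; apply: fA; rewrite ?mem_undup// -mem_undup. Qed.

Lemma cylinder_nil A : cylinder [::] A = setT.
Proof. by apply/seteqP; split. Qed.

Lemma measurable_cylinder s A : (forall e, measurable (A e)) ->
  measurable (cylinder s A : set env).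
Proof. by move=> mA; apply: sub_sigma_algebra; exists s, A. Qed.

Lemma cylinders_setI : setI_closed cylinders.
Proof.
move=> _ _ [s [A [mA ->]]] [t [B [mB ->]]].
exists (s ++ t), (fun e => (if e \in s then A e else setT) `&`
                           (if e \in t then B e else setT)); split.
  by move=> e; apply: measurableI; case: ifP.
apply/seteqP; split => f.
  by move=> [fA fB] e _; split; case: ifP => // es; [exact: fA|exact: fB].
by move=> fAB; split=> e es; have := fAB e; rewrite mem_cat es ?orbT => /(_ isT)[].
Qed.

Lemma env_measure_unique (m m' : {measure set env -> \bar R}) :
  (forall s A, uniq s -> (forall e, measurable (A e)) ->
    m (cylinder s A) = m' (cylinder s A)) ->
  (m setT < +oo)%E ->
  forall B : set env, measurable B -> m B = m' B.
Proof.
move=> mm' m_lty B mB.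
apply: (@measure_unique _ R env cylinders (fun=> setT)) => //.
- exact: cylinders_setI.
- by move=> _; exists [::], (fun=> setT); rewrite cylinder_nil.
- by rewrite bigcup_const//; exists 0%N.
- move=> _ [s [A [mA ->]]]; rewrite -cylinder_undup.
  by apply: mm' => //; exact: undup_uniq.
Qed.

Lemma measurable_env d (T : measurableType d) (X : T -> env) :
  (forall e, measurable_fun setT (fun w => X w e)) -> measurable_fun setT X.
Proof.
move=> mX; apply: (@measurability _ _ T env setT X cylinders) => //.
move=> _ [_ [s [A [mA ->]]] <-]; rewrite setTI.
rewrite (_ : _ @^-1` _ = \bigcap_(e in [set` s]) ((fun w => X w e) @^-1` A e)).
  by apply: fin_bigcap_measurable => // e _; rewrite -[_ @^-1` _]setTI; exact: mX.
by apply/seteqP; split => w h e /=; exact: h.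
Qed.

Lemma measurable_coord e : measurable_fun setT (fun f : env => f e).
Proof.
move=> _ A mA; rewrite setTI.
rewrite (_ : _ @^-1` _ = cylinder [:: e] (fun=> A)); first exact: measurable_cylinder.
apply/seteqP; split => f /=; first by move=> fA e'; rewrite inE => /eqP ->.
by move=> fA; apply: (fA e); rewrite inE.
Qed.

Definition shift_env z f : env := fun e => f (e + z).

Lemma measurable_shift_env z : measurable_fun setT (shift_env z).
Proof. by apply: measurable_env => e; exact: measurable_coord. Qed.

HB.instance Definition _ z :=
  isMeasurableFun.Build _ _ _ _ (shift_env z) (measurable_shift_env z).

Lemma shift_env_comp z z' f : shift_env z (shift_env z' f) = shift_env (z + z') f.
Proof. by apply/funext => e; rewrite /shift_env addrA. Qed.

Lemma shift_env_cylinder z s A :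
  shift_env z @^-1` cylinder s A = cylinder [seq e + z | e <- s] (fun e => A (e - z)).
Proof.
apply/seteqP; split => f fA e.
  by move=> /mapP[e' e's ->]; rewrite addrK; exact: fA.
by move=> es; rewrite -[e in A e](addrK z); apply: fA; rewrite (mem_map (@addIr _ z)).
Qed.

Definition zero_edges s f : env := fun e => if e \in s then 0 else f e.

Lemma measurable_zero_edges s : measurable_fun setT (zero_edges s).
Proof.
apply: measurable_env => e; rewrite /zero_edges; case: (e \in s).
  exact: measurable_cst.
exact: measurable_coord.
Qed.

HB.instance Definition _ s :=
  isMeasurableFun.Build _ _ _ _ (zero_edges s) (measurable_zero_edges s).

Lemma zero_edges_cons e s f : zero_edges (e :: s) f = zero_edge e (zero_edges s f).
Proof. by apply/funext => e'; rewrite /zero_edges /zero_edge inE; case: eqVneq. Qed.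

Lemma zero_edges_undup s : zero_edges (undup s) = zero_edges s.
Proof. by apply/funext => f; apply/funext => e; rewrite /zero_edges mem_undup. Qed.

Lemma zero_edges_cylinder s t A :
  zero_edges s @^-1` cylinder t A =
  if `[< forall e, e \in t -> e \in s -> A e 0 >] then cylinder [seq e <- t | e \notin s] A
  else set0.
Proof.
case: asboolP => [A0|nA0]; last first.
  apply/seteqP; split => // f fA; apply: nA0 => e et es.
  by have := fA e et; rewrite /zero_edges es.
apply/seteqP; split => f fA e.
  by rewrite mem_filter => /andP[es et]; have := fA e et; rewrite /zero_edges (negbTE es).
by move=> et; rewrite /zero_edges; case: ifPn => es; [exact: A0|apply: fA; rewrite mem_filter es].
Qed.

Definition iid_law (G : set R -> \bar R) (mu : set env -> \bar R) :=
  forall s A, uniq s -> (forall e, measurable (A e)) ->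
    mu (cylinder s A) = (\prod_(e <- s) G (A e))%E.

Section Law.
Variables (G : set R -> \bar R) (mu : probability env R).
Hypothesis mu_iid : iid_law G mu.

Lemma iid_law_unique (mu' : probability env R) : iid_law G mu' ->
  forall B : set env, measurable B -> mu B = mu' B.
Proof.
move=> mu'_iid; apply: env_measure_unique => [s A s_uniq mA|].
  by apply: etrans (mu_iid s_uniq mA) _; rewrite -mu'_iid.
by rewrite (le_lt_trans (probability_le1 _ _))// ltry.
Qed.

Lemma distribution_shift_env z (B : set env) : measurable B ->
  distribution mu (shift_env z) B = mu B.
Proof.
apply: env_measure_unique => [s A s_uniq mA|]; last first.
  by rewrite (le_lt_trans (probability_le1 _ _))// ltry.
rewrite [RHS]mu_iid// -[LHS]/(mu (shift_env z @^-1` cylinder s A)).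
rewrite shift_env_cylinder mu_iid//.
  by rewrite big_map; apply: eq_bigr => e _; rewrite addrK.
by rewrite map_inj_uniq//; exact: addIr.
Qed.

Lemma cylinderI_indep s t A B : uniq s -> uniq t -> ~~ has (mem s) t ->
  (forall e, measurable (A e)) -> (forall e, measurable (B e)) ->
  mu (cylinder s A `&` cylinder t B) = (mu (cylinder s A) * mu (cylinder t B))%E.
Proof.
move=> s_uniq t_uniq disj mA mB; have tNs e : e \in t -> (e \in s) = false.
  by move=> et; apply/negbTE; apply: (hasPn disj).
rewrite (_ : _ `&` _ = cylinder (s ++ t) (fun e => if e \in s then A e else B e)); last first.
  apply/seteqP; split => f; first move=> [fA fB] e.
    by rewrite mem_cat; case: ifPn => [/fA//|_ /fB].
  move=> fAB; split=> e es; have := fAB e; rewrite mem_cat es ?orbT => /(_ isT) //.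
  by rewrite tNs.
rewrite !mu_iid ?cat_uniq ?s_uniq ?t_uniq ?disj//; last by move=> e; case: ifP.
rewrite big_cat /=; congr (_ * _)%E; rewrite big_seq [RHS]big_seq; apply: eq_bigr => e.
  by move=> ->.
by move=> /tNs ->.
Qed.

Lemma cylinder_zero_edges_indep s A (B : set env) : (forall e, measurable (A e)) ->
  measurable B -> mu (cylinder s A `&` zero_edges s @^-1` B) =
  (mu (cylinder s A) * mu (zero_edges s @^-1` B))%E.
Proof.
move=> mA mB; rewrite -(cylinder_undup s A) -zero_edges_undup.
have := undup_uniq s; move: (undup s) => {}s s_uniq.
have mC : measurable (cylinder s A : set env) by exact: measurable_cylinder.
have muC_fin : mu (cylinder s A) \is a fin_num by exact: fin_num_measure.
pose p : {nonneg R} := NngNum (fine_ge0 (measure_ge0 mu (cylinder s A))).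
transitivity (mscale p (distribution mu (zero_edges s)) B); last by rewrite /mscale /= fineK.
transitivity (pushforward (mrestr mu mC) (zero_edges s) B).
  by rewrite /pushforward /mrestr setIC.
apply: env_measure_unique mB => [t A' t_uniq mA'|]; last first.
  exact: le_lt_trans (probability_le1 mu (measurableI _ _ measurableT mC)) (ltry _).
rewrite /= /mscale /= fineK// /distribution /pushforward /mrestr.
rewrite -[preimage _ _]/(zero_edges s @^-1` cylinder t A') zero_edges_cylinder.
case: ifP => _; last by rewrite set0I !measure0 mule0.
rewrite setIC cylinderI_indep ?filter_uniq//.
by apply/hasPn => e; rewrite mem_filter => /andP[].
Qed.

Lemma zero_one_law (E : set env) : measurable E ->
  (forall e f, E f <-> E (zero_edge e f)) -> mu E = 0%E \/ mu E = 1%E.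
Proof.
move=> mE zeroE.
have zero_edgesE s : zero_edges s @^-1` E = E.
  apply/funext => f; apply/propext; elim: s f => [|e s ih] f; first by [].
  rewrite /= zero_edges_cons; exact: iff_trans (iff_sym (zeroE _ _)) (ih f).
have muE_fin : mu E \is a fin_num by exact: fin_num_measure.
pose p : {nonneg R} := NngNum (fine_ge0 (measure_ge0 mu E)).
have : mrestr mu mE E = mscale p mu E.
  apply: (env_measure_unique _ _ mE) => [s A s_uniq mA|].
    rewrite /= /mscale /= fineK// /mrestr -{1}(zero_edgesE s).
    by rewrite cylinder_zero_edges_indep// zero_edgesE muleC.
  exact: le_lt_trans (probability_le1 mu (measurableI _ _ measurableT mE)) (ltry _).
rewrite /mrestr /mscale /= setIid fineK//.
move: muE_fin; case: (mu E) => // r _ [] /eqP.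
rewrite -subr_eq0 -{1}[r]mulr1 -mulrBr mulf_eq0 subr_eq0 (eq_sym 1).
by case/orP=> /eqP ->; [left|right].
Qed.

End Law.
End Environments.

(** * Expectations of integrable real functions *)

Section Mean.
Context d (T : measurableType d) (R : realType) (mu : probability T R).
Implicit Types (X Y : T -> R) (c M : R).

Definition mean X : R := \int[mu]_w X w.

Lemma Lfun1_measurable X : X \in Lfun mu 1 -> measurable_fun setT X.
Proof. by rewrite inE => /andP[/[!inE]]. Qed.

Lemma Lfun1_dominated X Y : measurable_fun setT X -> Y \in Lfun mu 1 ->
  (forall w, `|X w| <= Y w) -> X \in Lfun mu 1.
Proof.
move=> mX /Lfun1_integrable iY XY; apply/Lfun1_integrable.
apply: le_integrable iY => //; first exact/measurable_EFinP.
by move=> w _; rewrite /= lee_fin (le_trans (XY w))// ler_norm.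
Qed.

Lemma Lfun1_cst c : (fun=> c) \in Lfun mu 1.
Proof. exact: Lfun_cst. Qed.

Lemma Lfun1D X Y : X \in Lfun mu 1 -> Y \in Lfun mu 1 ->
  (fun w => X w + Y w) \in Lfun mu 1.
Proof. exact: rpredD. Qed.

Lemma Lfun1Z c X : X \in Lfun mu 1 -> (fun w => c * X w) \in Lfun mu 1.
Proof. exact: rpredZ. Qed.

Lemma Lfun1N X : X \in Lfun mu 1 -> (fun w => - X w) \in Lfun mu 1.
Proof. by move=> /(Lfun1Z (-1)); under eq_fun do rewrite mulN1r. Qed.

Lemma Lfun1_sum n (X : nat -> T -> R) : (forall i, X i \in Lfun mu 1) ->
  (fun w => \sum_(i < n) X i w) \in Lfun mu 1.
Proof.
move=> X_Lfun; elim: n => [|n ih].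
  by under eq_fun do rewrite big_ord0; exact: Lfun1_cst.
by under eq_fun do rewrite big_ord_recr; exact: Lfun1D.
Qed.

Lemma mean_cst c : mean (fun=> c) = c.
Proof.
rewrite /mean Rintegral_cst// -[RHS]mulr1; congr (_ * _).
by rewrite [X in fine X](probability_setT mu).
Qed.

Lemma meanD X Y : X \in Lfun mu 1 -> Y \in Lfun mu 1 ->
  mean (fun w => X w + Y w) = mean X + mean Y.
Proof. by move=> /Lfun1_integrable iX /Lfun1_integrable iY; exact: RintegralD. Qed.

Lemma meanZ c X : X \in Lfun mu 1 -> mean (fun w => c * X w) = c * mean X.
Proof. by move=> /Lfun1_integrable iX; exact: RintegralZl. Qed.

Lemma meanN X : X \in Lfun mu 1 -> mean (fun w => - X w) = - mean X.
Proof. by move=> /(meanZ (-1)); rewrite mulN1r => <-; under eq_fun do rewrite -mulN1r. Qed.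

Lemma mean_sum n (X : nat -> T -> R) : (forall i, X i \in Lfun mu 1) ->
  mean (fun w => \sum_(i < n) X i w) = \sum_(i < n) mean (X i).
Proof.
move=> X_Lfun; elim: n => [|n ih].
  by under eq_fun do rewrite big_ord0; rewrite mean_cst big_ord0.
under eq_fun do rewrite big_ord_recr.
by rewrite meanD ?big_ord_recr ?ih//; exact: Lfun1_sum.
Qed.

Lemma mean_ge0 X : (forall w, 0 <= X w) -> 0 <= mean X.
Proof. by move=> X_ge0; exact: Rintegral_ge0. Qed.

Lemma le_mean X Y : X \in Lfun mu 1 -> Y \in Lfun mu 1 ->
  (forall w, X w <= Y w) -> mean X <= mean Y.
Proof.
by move=> /Lfun1_integrable iX /Lfun1_integrable iY XY; exact: le_Rintegral.
Qed.

Lemma integral_mean X : X \in Lfun mu 1 -> (\int[mu]_w (X w)%:E)%E = (mean X)%:E.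
Proof. by move=> /Lfun1_integrable iX; rewrite /mean /Rintegral fineK// integrable_fin_num. Qed.

Lemma mean_dominated_cvg (X : nat -> T -> R) (X_lim Y : T -> R) :
  (forall n, measurable_fun setT (X n)) -> measurable_fun setT X_lim ->
  {ae mu, forall w, X ^~ w @ \oo --> X_lim w} ->
  Y \in Lfun mu 1 -> (forall n w, `|X n w| <= Y w) ->
  (fun n => mean (X n)) @ \oo --> mean X_lim.
Proof.
move=> mX mX_lim X_cvg /Lfun1_integrable iY XY.
have [|||||iX_lim _ int_cvg] := @dominated_convergence _ T R mu setT measurableT
  (fun n => EFin \o X n) (EFin \o X_lim) (EFin \o Y).
- by move=> n; exact/measurable_EFinP.
- exact/measurable_EFinP.
- by apply: filterS X_cvg => w X_cvg _; apply: cvg_EFin => //; exact: nearW.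
- exact: iY.
- by apply: aeW => w n _; rewrite /= lee_fin.
by apply: fine_cvg; rewrite fineK// integrable_fin_num.
Qed.

Lemma scheffe (X : nat -> T -> R) (X_lim : T -> R) :
  (forall n, X n \in Lfun mu 1) -> X_lim \in Lfun mu 1 -> (forall n w, 0 <= X n w) ->
  {ae mu, forall w, X ^~ w @ \oo --> X_lim w} ->
  (fun n => mean (X n)) @ \oo --> mean X_lim ->
  (fun n => mean (fun w => `|X n w - X_lim w|)) @ \oo --> (0 : R).
Proof.
move=> X_Lfun lim_Lfun X_ge0 X_cvg mean_cvg.
(* Twice the negative part of [X n - X_lim], hence dominated. *)
pose deficit n w := `|X n w - X_lim w| - (X n w - X_lim w).
have dev_Lfun n : (fun w => X n w - X_lim w) \in Lfun mu 1.
  exact: Lfun1D (X_Lfun n) (Lfun1N lim_Lfun).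
have deficit_Lfun n : deficit n \in Lfun mu 1.
  exact: Lfun1D (Lfun_norm (dev_Lfun n)) (Lfun1N (dev_Lfun n)).
have deficit_cvg : (fun n => mean (deficit n)) @ \oo --> (0 : R).
  rewrite -[in X in _ --> X](mean_cst 0).
  apply: mean_dominated_cvg (Lfun1Z 2 (Lfun_norm lim_Lfun)) _ => //.
  - by move=> n; exact: Lfun1_measurable (deficit_Lfun n).
  - apply: filterS X_cvg => w X_cvg.
    have dev_cvg : (fun n => X n w - X_lim w) @ \oo --> (0 : R).
      by rewrite -(subrr (X_lim w)); apply: cvgB => //; exact: cvg_cst.
    have -> : (0 : R) = `|(0 : R)| - 0 by rewrite (normr0 R) subr0.
    by apply: cvgB => //; exact: cvg_norm.
  - move=> n w /=; rewrite ger0_norm /deficit ?subr_ge0 ?ler_norm//.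
    have := X_ge0 n w; have := ler_norm (X_lim w); have := normr_ge0 (X_lim w).
    by case: (ger0P (X n w - X_lim w)); lra.
have abs_dev n : (fun w => `|X n w - X_lim w|) = fun w => (X n w - X_lim w) + deficit n w.
  by apply/funext => w; rewrite /deficit; ring.
have -> : (fun n => mean (fun w => `|X n w - X_lim w|)) =
    fun n => mean (X n) - mean X_lim + mean (deficit n).
  apply/funext => n; rewrite abs_dev (meanD (dev_Lfun n))//.
  by rewrite (meanD (X_Lfun n) (Lfun1N lim_Lfun)) meanN.
have -> : (0 : R) = mean X_lim - mean X_lim + 0 by rewrite subrr addr0.
by apply: cvgD deficit_cvg; apply: cvgB mean_cvg _; exact: cvg_cst.
Qed.

Lemma mean_indicC_cvg0 (A : nat -> set T) Y :
  (forall n, measurable (A n)) -> nondecreasing_seq A -> mu (\bigcup_n A n) = 1%E ->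
  Y \in Lfun mu 1 -> (fun n => mean (fun w => \1_(~` A n) w * Y w)) @ \oo --> (0 : R).
Proof.
move=> mA ndA muA Y_Lfun; rewrite -[in X in _ --> X](mean_cst 0).
have mY := Lfun1_measurable Y_Lfun.
apply: mean_dominated_cvg (Lfun_norm Y_Lfun) _ => //.
- move=> n; apply: measurable_funM => //.
  by apply: measurable_indic; exact: measurableC.
- have mU : measurable (\bigcup_n A n) by exact: bigcupT_measurable.
  exists (~` \bigcup_n A n); split; first exact: measurableC.
    by rewrite probability_setC// muA subee.
  move=> w /=; apply: contra_not => -[n0 _ An0].
  apply: cvg_near_cst; exists n0 => // n /= n0n.
  by rewrite indicE in_setC mem_set ?mul0r//; exact: (subsetPset _ _ (ndA _ _ n0n)).
- move=> n w /=; rewrite normrM ler_piMl// indicE.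
  by case: (_ \in _); rewrite ?normr1 ?normr0.
Qed.

Lemma Lfun1_stopping X (C : nat -> set T) c M :
  measurable_fun setT X -> (forall k, measurable (C k)) -> 0 <= c -> 0 <= M ->
  (\sum_(k <oo) mu (C k) < +oo)%E ->
  (forall w, exists2 j : nat, `|X w| <= M + c * j%:R & forall k, (k < j)%N -> C k w) ->
  X \in Lfun mu 1.
Proof.
move=> mX mC c_ge0 M_ge0 muC_lty X_le.
pose count w : \bar R := (\sum_(k <oo) (\1_(C k) w)%:E)%E.
have mI k : measurable_fun setT (fun w => (\1_(C k) w)%:E : \bar R).
  by apply/measurable_EFinP; exact: measurable_indic.
have count_ge0 w : (0 <= count w)%E by apply: nneseries_ge0 => k _ _; rewrite lee_fin.
have mcount : measurable_fun setT count.
  by apply: ge0_emeasurable_sum => // k w _ _; rewrite lee_fin.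
have X_le_count w : (`|(X w)%:E| <= M%:E + c%:E * count w)%E.
  have [j Xj Cj] := X_le w; apply: (@le_trans _ _ (M + c * j%:R)%:E); first by rewrite lee_fin.
  rewrite EFinD EFinM leeD2l// lee_wpmul2l// ?lee_fin//.
  apply: (@le_trans _ _ (\sum_(0 <= k < j) (\1_(C k) w)%:E)%E); last first.
    by apply: nneseries_lim_ge => k _ _; rewrite lee_fin.
  rewrite (eq_big_nat _ _ (F2 := fun=> 1%E)); first by rewrite sumEFin sumr_const_nat subn0.
  by move=> k /andP[_ /Cj Ck]; rewrite indicE mem_set.
apply/Lfun1_integrable/integrableP; split; first exact/measurable_EFinP.
apply: (@le_lt_trans _ _ (\int[mu]_w (M%:E + c%:E * count w))%E).
  apply: ge0_le_integral => //; first by apply: measurableT_comp => //; exact/measurable_EFinP.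
    by apply: emeasurable_funD => //; exact: measurable_funeM.
  by move=> w _; exact: X_le_count.
rewrite ge0_integralD//; last 2 first.
- by move=> w _; rewrite mule_ge0.
- exact: measurable_funeM.
rewrite ge0_integralZl// integral_cst// [X in (_ * X + _)%E]probability_setT mule1.
rewrite integral_nneseries//; under eq_eseriesr do rewrite integral_indic// setIT.
rewrite lte_add_pinfty ?ltry// lte_mul_pinfty//.
Qed.

End Mean.

Lemma measurable_inf_range d (T : measurableType d) (R : realType) (X : nat -> T -> R) :
  (forall n, measurable_fun setT (X n)) ->
  measurable_fun setT (fun w => inf (range (X ^~ w))).
Proof.
move=> mX.
rewrite (_ : (fun _ => _) = fine \o (fun w => einfs (fun n => (X n w)%:E) 0)).
  apply: measurableT_comp; first exact: fine_measurable.
  by apply: measurable_fun_einfs => n; exact/measurable_EFinP.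
apply/funext => w; rewrite /= /einfs /sdrop /=.
have -> : [set (X n w)%:E | n in [set n | (0 <= n)%N]] = EFin @` range (X ^~ w).
  by rewrite image_comp; congr image; apply/seteqP.
have range_neq0 : range (X ^~ w) !=set0 by exists (X 0%N w), 0%N.
have [bounded|unbounded] := pselect (has_lbound (range (X ^~ w))).
  by rewrite ereal_inf_EFin.
rewrite inf_out; last by case.
have inf_le x : range (X ^~ w) x -> (ereal_inf (EFin @` range (X ^~ w)) <= x%:E)%E.
  by move=> Xx; apply: ereal_inf_lbound; exists x.
case: ereal_inf inf_le => [y||] inf_le //; case: unbounded.
by exists y => x /inf_le; rewrite lee_fin.
Qed.

Section ImageLaw.
Context d d' (T : measurableType d) (T' : measurableType d') (R : realType).

Lemma eq_measure_mean (mu mu' : probability T R) (X : T -> R) :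
  (forall A, measurable A -> mu A = mu' A) -> mean mu X = mean mu' X.
Proof.
move=> mu_eq; congr fine; apply: eq_measure_integral => A mA _; exact: mu_eq.
Qed.

Lemma eq_measure_Lfun1 (mu mu' : probability T R) (X : T -> R) :
  (forall A, measurable A -> mu A = mu' A) -> X \in Lfun mu 1 -> X \in Lfun mu' 1.
Proof.
move=> mu_eq /Lfun1_integrable/integrableP[mX X_lty].
apply/Lfun1_integrable/integrableP; split=> //.
apply: le_lt_trans X_lty; rewrite le_eqVlt; apply/orP; left; apply/eqP.
by apply: eq_measure_integral => A mA _; exact/esym/mu_eq.
Qed.

Variables (mu : probability T R) (X : {mfun T >-> T'}) (Y : T' -> R).
Hypothesis Y_Lfun : Y \in Lfun (distribution mu X) 1.

Lemma Lfun1_distribution : Y \o X \in Lfun mu 1.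
Proof.
have /Lfun1_integrable/integrableP[mY Y_lty] := Y_Lfun.
apply/Lfun1_integrable/integrableP; split; first exact: measurableT_comp mY _.
apply: le_lt_trans Y_lty; rewrite ge0_integral_distribution//.
exact: measurableT_comp mY.
Qed.

Lemma mean_distribution : mean mu (Y \o X) = mean (distribution mu X) Y.
Proof.
rewrite /mean /Rintegral (@integral_distribution _ _ _ _ _ mu X (EFin \o Y))//.
- exact/measurable_EFinP/(Lfun1_measurable Y_Lfun).
- exact/Lfun1_integrable/Lfun1_distribution.
Qed.

End ImageLaw.

Section ShiftedExpectation.
Variables (R : realType) (G : set R -> \bar R) (mu : probability (env R) R).
Hypothesis mu_iid : iid_law G mu.
Variables (z : pt) (X : env R -> R).
Hypothesis X_Lfun : X \in Lfun mu 1.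

Let X_Lfun_shift : X \in Lfun (distribution mu (shift_env z)) 1.
Proof.
by apply: eq_measure_Lfun1 X_Lfun => A mA; exact/esym/(distribution_shift_env mu_iid).
Qed.

Lemma Lfun1_shift_env : (fun f => X (shift_env z f)) \in Lfun mu 1.
Proof. exact: Lfun1_distribution X_Lfun_shift. Qed.

Lemma mean_shift_env : mean mu (fun f => X (shift_env z f)) = mean mu X.
Proof.
rewrite -[LHS]/(mean mu (X \o shift_env z)) (mean_distribution X_Lfun_shift).
by apply: eq_measure_mean => A mA; exact: (distribution_shift_env mu_iid).
Qed.

End ShiftedExpectation.

Lemma ae_shift_env (R : realType) (G : set R -> \bar R) (mu : probability (env R) R)
    (Q : env R -> Prop) z :
  iid_law G mu -> {ae mu, forall f, Q f} -> {ae mu, forall f, Q (shift_env z f)}.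
Proof.
move=> mu_iid [N [mN N0 QN]]; exists (shift_env z @^-1` N); split.
- by rewrite -[X in measurable X]setTI; exact: measurable_shift_env.
- by rewrite -[LHS]/(distribution mu (shift_env z) N) (distribution_shift_env mu_iid).
- by move=> f nQ; apply: QN.
Qed.

(** * A one-sided ergodic theorem for superadditive processes *)

Lemma measurable_le_line d (T : measurableType d) (R : realType) (u : nat -> T -> R) c :
  (forall n, measurable_fun setT (u n)) -> measurable [set w | le_line (u ^~ w) c].
Proof.
move=> meas_u.
rewrite (_ : [set w | _] =
  \bigcup_b \bigcap_n u n @^-1` [set x | x <= c * n%:R + b%:R]).
  apply: bigcupT_measurable => b; apply: bigcapT_measurable => n.
  rewrite -[_ @^-1` _]setTI; apply: meas_u => //.
  by rewrite -set_itvNyc; exact: measurable_itv.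
apply/seteqP; split => w [b].
  move=> ub; exists (Num.truncn b).+1 => // n _ /=.
  by apply: le_trans (ub n) _; rewrite lerD2l ltW// truncnS_gt.
by move=> _ ub; exists b%:R => n; exact: ub.
Qed.

Lemma ae_rate_le_of_lines d (T : measurableType d) (R : realType) (mu : probability T R)
    (u : nat -> T -> R) c :
  (forall e, 0 < e -> {ae mu, forall w, le_line (u ^~ w) (c + e)}) ->
  {ae mu, forall w, rate_le (u ^~ w) c}.
Proof.
move=> line_ae; have invS_gt0 (j : nat) : 0 < j.+1%:R^-1 :> R by rewrite invr_gt0.
by apply: filterS (ae_foralln (fun j => line_ae _ (invS_gt0 j))) => w /rate_leP.
Qed.

Section OneSidedErgodic.
Variables (R : realType) (G : set R -> \bar R) (mu : probability (env R) R).
Hypothesis mu_iid : iid_law G mu.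
Variables (z : nat -> pt) (v : nat -> nat -> env R -> R) (K : R).
Hypothesis v_super : forall i j k f, (i <= j <= k)%N -> v i j f + v j k f <= v i k f.
Hypothesis v_diag : forall i f, 0 <= v i i f.
Hypothesis v_translate_le : forall i n f,
  v 0 n (shift_env (z i) f) <= v i (i + n)%N f + K.
Hypothesis v_Lfun : forall n, v 0 n \in Lfun mu 1.
Hypothesis v_zero_edge : forall e f, exists b : R, forall n,
  `|v 0 n f - v 0 n (zero_edge e f)| <= b.

Let mv n : measurable_fun setT (v 0 n).
Proof. exact: Lfun1_measurable (v_Lfun n). Qed.

Definition jump_set c N : set (env R) :=
  [set f | exists2 n, (0 < n <= N)%N & c * n%:R + `|K| < v 0 n f].

Lemma measurable_jump_set c N : measurable (jump_set c N).
Proof.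
rewrite (_ : jump_set c N = \bigcup_(n in [set n | (0 < n <= N)%N])
  v 0 n @^-1` [set x | c * n%:R + `|K| < x]).
  apply: bigcup_measurable => n _; rewrite -[_ @^-1` _]setTI; apply: mv => //.
  by rewrite -set_itvoy; exact: measurable_itv.
by apply/seteqP; split => f [n]; exists n.
Qed.

Lemma nondecreasing_jump_set c : nondecreasing_seq (jump_set c).
Proof.
move=> M N MN; apply/subsetPset => f [n /andP[n_gt0 nM] jump_n].
by exists n; rewrite // n_gt0 (leq_trans nM).
Qed.

Lemma not_le_line_bigcup_jump_set c : ~` [set f | le_line (fun n => v 0 n f) c] `<=` \bigcup_N jump_set c N.
Proof.
move=> f /= no_line.
have [n jump_n] : exists n, c * n%:R + `|K| < v 0 n f.
  apply: contrapT => no_jump; apply: no_line; exists `|K| => n.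
  by rewrite leNgt; apply/negP => jump_n; apply: no_jump; exists n.
exists n => //; exists n => //; rewrite leqnn andbT lt0n; apply/eqP => n0.
have := @v_super 0 0 0 f isT; have := normr_ge0 K.
by move: jump_n; rewrite n0; lra.
Qed.

Definition jump_cost (c : R) (f : env R) : R := `|v 0 1 f| + (`|K| + `|c|).

Lemma jump_cost_Lfun c : jump_cost c \in Lfun mu 1.
Proof. by apply: Lfun1D (Lfun1_cst _ _); exact: (Lfun_norm (v_Lfun 1)). Qed.

Lemma jump_cost_ge0 c f : 0 <= jump_cost c f.
Proof. by rewrite !addr_ge0. Qed.

Lemma jump_chain c N m f : c * m%:R <= v 0 m f +
  \sum_(i < m) (\1_(~` jump_set c N) (shift_env (z i) f) + (m < i + N)%N%:R) *
               jump_cost c (shift_env (z i) f).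
Proof.
under eq_bigr do rewrite indicE in_setC.
apply: (@greedy_chain _ (fun i j => v i j f) (fun i => jump_cost c (shift_env (z i) f))
  (fun i => shift_env (z i) f \notin jump_set c N)).
- by move=> i j k; exact: v_super.
- by move=> i; exact: v_diag.
- by move=> i; exact: jump_cost_ge0.
- move=> i; have := v_translate_le i 1 f; rewrite addn1 /jump_cost.
  have := lerNnormlW (lexx `|v 0 1 (shift_env (z i) f)|).
  have := ler_norm K; have := ler_norm c; lra.
- move=> i; rewrite negbK inE => -[n n_bounds jump_n]; exists n => //.
  by have := v_translate_le i n f; have := ler_norm K; lra.
Qed.

Lemma mean_jump_chain c N m : c * m%:R <= mean mu (v 0 m) +
  (m%:R * mean mu (fun f => \1_(~` jump_set c N) f * jump_cost c f) +
   N%:R * mean mu (jump_cost c)).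
Proof.
have cost_Lfun := jump_cost_Lfun c; have mcost := Lfun1_measurable cost_Lfun.
pose penalty (i : nat) f := (\1_(~` jump_set c N) f + (m < i + N)%N%:R) * jump_cost c f.
have bad_Lfun : (fun f => \1_(~` jump_set c N) f * jump_cost c f) \in Lfun mu 1.
  apply: Lfun1_dominated cost_Lfun _ => [|f].
    apply: measurable_funM => //; apply: measurable_indic; apply: measurableC.
    exact: measurable_jump_set.
  rewrite ger0_norm ?mulr_ge0 ?jump_cost_ge0// ?indicE//.
  by rewrite ler_piMl ?jump_cost_ge0//; case: (_ \in _).
have penaltyE i : penalty i = fun f =>
    \1_(~` jump_set c N) f * jump_cost c f + (m < i + N)%N%:R * jump_cost c f.
  by apply/funext => f; rewrite /penalty mulrDl.
have penalty_Lfun i : penalty i \in Lfun mu 1.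
  by rewrite penaltyE; apply: Lfun1D => //; exact: Lfun1Z.
have shifted_Lfun i : (fun f => penalty i (shift_env (z i) f)) \in Lfun mu 1.
  exact: (Lfun1_shift_env mu_iid).
rewrite -[leLHS](mean_cst mu); apply: (le_trans (le_mean _ _ (jump_chain c N m))).
- exact: Lfun1_cst.
- by apply: Lfun1D => //; exact: (Lfun1_sum _ shifted_Lfun).
rewrite (meanD (v_Lfun m) (Lfun1_sum m shifted_Lfun)) (mean_sum m shifted_Lfun) lerD2l.
under eq_bigr => i _ do rewrite (mean_shift_env mu_iid _ (penalty_Lfun i)) penaltyE
  meanD ?meanZ ?Lfun1Z//.
rewrite big_split /= sumr_const card_ord mulr_natl lerD2l -mulr_suml.
by rewrite ler_wpM2r ?sum_near_end_le ?mean_ge0//; exact: jump_cost_ge0.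
Qed.

Lemma probability_le_line s c : rate_le (fun m => mean mu (v 0 m)) s -> s < c ->
  mu [set f | le_line (fun n => v 0 n f) c] = 1%E.
Proof.
move=> mean_rate s_lt_c; set L := [set f | _].
have mL : measurable L by exact: measurable_le_line.
have [|mL0|//] := zero_one_law mu_iid mL.
  move=> e f; have [b perturb_le] := v_zero_edge e f.
  by split; apply: (@le_line_le_addr _ _ _ b) => n; have := perturb_le n;
    rewrite ler_distl; lra.
exfalso; have mJ N : measurable (jump_set c N) by exact: measurable_jump_set.
have J_full : mu (\bigcup_N jump_set c N) = 1%E.
  apply/eqP; rewrite eq_le probability_le1//=; last exact: bigcupT_measurable.
  rewrite -(sube0 1%E) -mL0 -probability_setC// le_measure ?inE//.
  - exact: measurableC.
  - exact: bigcupT_measurable.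
  - exact: not_le_line_bigcup_jump_set.
pose eta := (c - s) / 3; have eta_gt0 : 0 < eta by rewrite divr_gt0// subr_gt0.
have /cvgrPdist_le/(_ _ eta_gt0)[N _ /(_ N (leqnn N))/=] :=
  mean_indicC_cvg0 mJ (@nondecreasing_jump_set c) J_full (jump_cost_Lfun c).
rewrite sub0r normrN => /(le_trans (ler_norm _)) bad_le.
have [b mean_le] := mean_rate _ eta_gt0.
have : c <= s + eta + eta; last by rewrite /eta; lra.
apply: (@le_of_linear _ _ _ (b + N%:R * mean mu (jump_cost c))) => m.
apply: le_trans (mean_jump_chain c N m) _.
have := ler_wpM2l (ler0n R m) bad_le; have := mean_le m; rewrite mulrDl (mulrC m%:R eta); lra.
Qed.

Theorem ae_rate_le_superadditive s : rate_le (fun m => mean mu (v 0 m)) s ->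
  {ae mu, forall f, rate_le (fun n => v 0 n f) s}.
Proof.
move=> mean_rate; apply: ae_rate_le_of_lines => e e_gt0.
have mL := measurable_le_line (s + e) mv.
exists (~` [set f | le_line (fun n => v 0 n f) (s + e)]); split => //.
  exact: measurableC.
by rewrite probability_setC// (probability_le_line mean_rate) ?subee// ltrDl.
Qed.

End OneSidedErgodic.

Section OneSidedStrongLaw.
Variables (R : realType) (G : set R -> \bar R) (mu : probability (env R) R).
Hypothesis mu_iid : iid_law G mu.
Variables (z : pt) (X : env R -> R).
Hypothesis X_Lfun : X \in Lfun mu 1.
Hypothesis X_local : forall e f, exists i0, forall i, (i0 <= i)%N ->
  X (shift_env (z *+ i) (zero_edge e f)) = X (shift_env (z *+ i) f).

Definition orbit_sum (i j : nat) f := \sum_(i <= k < j) X (shift_env (z *+ k) f).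

Lemma orbit_sum_shift i n f :
  orbit_sum 0 n (shift_env (z *+ i) f) = orbit_sum i (i + n) f.
Proof.
rewrite /orbit_sum -[i in RHS]add0n big_addn addKn; apply: eq_bigr => k _.
by rewrite shift_env_comp -mulrnDr.
Qed.

Lemma orbit_sum_zero_edge e f : exists b : R, forall n,
  `|orbit_sum 0 n f - orbit_sum 0 n (zero_edge e f)| <= b.
Proof.
pose change i := `|X (shift_env (z *+ i) f) - X (shift_env (z *+ i) (zero_edge e f))|.
have [i0 change0] := X_local e f; exists (\sum_(0 <= i < i0) change i) => n.
rewrite /orbit_sum -sumrB; apply: le_trans (ler_norm_sum _ _ _) _.
have [n_le|/ltnW i0_le] := leqP n i0.
  by rewrite [leRHS](@big_cat_nat _ _ _ n)//= lerDl sumr_ge0// => i _; exact: normr_ge0.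
rewrite [leLHS](@big_cat_nat _ _ _ i0)//= [X in _ + X]big1_seq ?addr0// => i.
by rewrite mem_index_iota => /andP[_ /andP[/change0 -> _]]; rewrite subrr normr0.
Qed.

Theorem one_sided_strong_law :
  {ae mu, forall f, rate_le (fun n => orbit_sum 0 n f) (mean mu X)}.
Proof.
have X_shift (i : nat) : (fun f => X (shift_env (z *+ i) f)) \in Lfun mu 1.
  exact: (Lfun1_shift_env mu_iid).
have sumE n : orbit_sum 0 n = fun f => \sum_(i < n) X (shift_env (z *+ i) f).
  by apply/funext => f; rewrite /orbit_sum big_mkord.
apply: (@ae_rate_le_superadditive _ _ _ mu_iid (fun i => z *+ i) orbit_sum 0).
- by move=> i j k f /andP[ij jk]; rewrite -big_cat_nat.
- by move=> i f; rewrite /orbit_sum big_geq.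
- by move=> i n f; rewrite addr0 orbit_sum_shift.
- by move=> n; rewrite sumE; exact: (Lfun1_sum n X_shift).
- exact: orbit_sum_zero_edge.
move=> e e_gt0; exists 0 => n; rewrite sumE (mean_sum n X_shift) addr0.
under eq_bigr do rewrite (mean_shift_env mu_iid _ X_Lfun).
by rewrite sumr_const card_ord -[leLHS]mulr_natr ler_wpM2r// lerDl ltW.
Qed.

End OneSidedStrongLaw.

(** * Passage times in a random environment *)

Section EnvironmentTime.
Variable R : realType.
Implicit Types (I J : interval int) (e u v w z : pt) (f : env R) (x y : int).

(* Taking absolute values keeps every time nonnegative without restricting the
   environment space; under the law of the model it changes nothing a.s. *)
Definition time I u w f : R := restricted_time I (fun e => `|f e|) u w.

Lemma time_ge0 I u w f : 0 <= time I u w f.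
Proof. exact: restricted_time_ge0. Qed.

Lemma time_triangle I v u w f : u.1 \in I -> v.1 \in I -> w.1 \in I ->
  time I u w f <= time I u v f + time I v w f.
Proof. exact: restricted_time_triangle. Qed.

Lemma time_sub I J u w f : {subset I <= J} -> u.1 \in I -> w.1 \in I ->
  time J u w f <= time I u w f.
Proof. exact: restricted_time_sub. Qed.

Lemma time_refl I u f : u.1 \in I -> time I u u f = 0.
Proof.
move=> uI; apply/eqP; rewrite eq_le time_ge0 andbT.
by apply: restricted_time_le => //; exact: reaches_refl.
Qed.

Lemma time_shift I J u w z f : (forall x, (x + z.1 \in J) = (x \in I)) ->
  time I u w (shift_env z f) = time J (u + z) (w + z) f.
Proof. by move=> IJ; exact: (restricted_time_shift (fun e => `|f e|) u w IJ). Qed.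

Lemma time_vert_end I u x y y' f : u.1 \in I -> x \in I ->
  time I u (x, y') f <= time I u (x, y) f + `|y' - y|%:~R.
Proof.
move=> uI xI; apply: le_trans (@time_triangle I (x, y) u (x, y') f uI xI xI) _.
by rewrite lerD2l; exact: restricted_time_vert.
Qed.

Lemma norm_zero_edge e f :
  (fun e' => `|zero_edge e f e'|) = zero_edge e (fun e' => `|f e'|).
Proof. by apply/funext => e'; rewrite /zero_edge; case: eqP; rewrite ?normr0. Qed.

Lemma time_zero_edge I e u w f : u.1 \in I -> w.1 \in I ->
  `|time I u w f - time I u w (zero_edge e f)| <= `|f e|.
Proof.
move=> uI wI; rewrite /time norm_zero_edge.
exact: (@restricted_time_zero_edge _ I (fun e' => `|f e'|) e u w).
Qed.

Lemma time_zero_edge_out I e u w f : e.1 \notin I ->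
  time I u w (zero_edge e f) = time I u w f.
Proof. by move=> eI; rewrite /time norm_zero_edge restricted_time_zero_edge_out. Qed.

Lemma pair_mulrn (V W : nmodType) (z : V * W) k : z *+ k = (z.1 *+ k, z.2 *+ k).
Proof. by rewrite [LHS]surjective_pairing; congr pair; rewrite raddfMn. Qed.

Lemma strip_time_local (a b : int) z u w e f : 0 < z.1 ->
  exists i0, forall i, (i0 <= i)%N ->
  time `[a, b] u w (shift_env (z *+ i) (zero_edge e f)) =
  time `[a, b] u w (shift_env (z *+ i) f).
Proof.
move=> z_gt0; exists (absz (e.1 - a)).+1 => i i_large.
have zi_ge : i%:Z <= (z *+ i).1 by rewrite pair_mulrn /= -mulr_natr natz ler_peMl.
have shifted x : (x + (z *+ i).1 \in `[a + (z *+ i).1, b + (z *+ i).1]) = (x \in `[a, b]).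
  by rewrite !in_itv /= !lerD2r.
rewrite !(time_shift _ _ _ shifted) time_zero_edge_out// in_itv.
by move: (z *+ i).1 zi_ge => {shifted} zi /=; lia.
Qed.

Lemma measurable_path_time d (T : measurableType d) (hw : T -> pt -> R) u (p : seq pt) :
  (forall e, measurable_fun setT (hw ^~ e)) ->
  measurable_fun setT (fun t => path_time (hw t) u p).
Proof.
move=> mhw; elim: p u => [|z p ih] u.
  by under eq_fun do rewrite path_time_nil; exact: measurable_cst.
under eq_fun do rewrite path_time_cons; apply: measurable_funD => //.
by rewrite /edge_weight; case: (u.2 == z.2).
Qed.

Lemma measurable_restricted_time d (T : measurableType d) (hw : T -> pt -> R) I u w :
  (forall e, measurable_fun setT (hw ^~ e)) ->
  measurable_fun setT (fun t => restricted_time I (hw t) u w).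
Proof.
move=> mhw; have [[p0 p0I]|no_path] := pselect (exists p, path_in I u w p); last first.
  rewrite (_ : (fun _ => _) = cst 0); first exact: measurable_cst.
  apply/funext => t; rewrite /restricted_time (_ : path_in I u w = set0) ?image_set0 ?inf0//.
  by apply/seteqP; split => // p pI; apply: no_path; exists p.
pose enum_path k := if unpickle k is Some p
  then if `[< path_in I u w p >] then p else p0 else p0.
have enum_pathP k : path_in I u w (enum_path k).
  by rewrite /enum_path; case: unpickle => // p; case: ifP => // /asboolP.
rewrite (_ : (fun _ => _) = fun t => inf (range (fun k => path_time (hw t) u (enum_path k)))).
  by apply: measurable_inf_range => k; exact: measurable_path_time.
apply/funext => t; congr inf; apply/seteqP; split => c [].
  by move=> p pI <-; exists (pickle p) => //; rewrite /enum_path pickleK asboolT.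
by move=> k _ <-; exists (enum_path k).
Qed.

Lemma measurable_time I u w : measurable_fun setT (time I u w).
Proof.
apply: measurable_restricted_time => e.
by apply: measurableT_comp => //; exact: measurable_coord.
Qed.

Definition cross f : R := time `[0, 1] (0, 0) (1, 0) f.

Lemma cross_le (j : nat) f : cross f <= `|f (0, j%:Z)| + 2 * j%:R.
Proof.
have -> : `|f (0, j%:Z)| + 2 * j%:R = `|j%:Z - 0|%:~R + `|f (0, j%:Z)| + `|0 - j%:Z|%:~R.
  by rewrite subr0 sub0r normrN [`|j%:Z|]ger0_norm// -[_%:~R]/(j%:R); ring.
apply: restricted_time_le => //.
apply: reaches_trans (reaches_vert _ j%:Z 0 _) => //.
apply: reaches_trans (reaches_vert _ 0 j%:Z _) _ => //.
exact: (@reaches_horiz _ _ _ 0 j%:Z).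
Qed.

Lemma time_le_cross I x y f : x \in I -> x + 1 \in I ->
  time I (x, y) (x + 1, y) f <= cross (shift_env (x, y) f).
Proof.
move=> xI x1I; rewrite /cross (@time_shift _ `[x, x + 1]); last first.
  by move=> t; rewrite !in_itv /=; lia.
rewrite -[(0, 0) + _]/(0 + x, 0 + y) -[(1, 0) + _]/(1 + x, 0 + y) !add0r (addrC 1).
apply: time_sub; [|by rewrite in_itv /=; lia..].
by move=> t; rewrite in_itv /=; exact: mem_interval_between.
Qed.

Lemma time_le_sum_cross I x (n : nat) y y' f : x \in I -> x + n%:Z \in I ->
  time I (x, y) (x + n%:Z, y') f <=
  \sum_(i < n) cross (shift_env (x + i%:Z, y) f) + `|y' - y|%:~R.
Proof.
move=> xI xnI; apply: le_trans (@time_vert_end I (x, y) _ y y' f xI xnI) _.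
rewrite lerD2r; elim: n xnI => [|n ih] xnI; first by rewrite addr0 time_refl// big_ord0.
have xn'I : x + n%:Z \in I by apply: mem_interval_between xI xnI _; lia.
have xSn : x + n.+1%:Z = x + n%:Z + 1 by lia.
rewrite big_ord_recr /=.
have := @time_triangle I (x + n%:Z, y) (x, y) (x + n.+1%:Z, y) f xI xn'I xnI.
move=> /le_trans; apply.
by rewrite lerD ?ih// xSn time_le_cross// -xSn.
Qed.

End EnvironmentTime.

Lemma exists_norm_tail_le (R : realType) (G : probability R R) (eps : R) : 0 < eps ->
  exists2 M : R, 0 <= M & (G [set x | (M < `|x|)%R] <= eps%:E)%E.
Proof.
move=> eps_gt0; pose tail (n : nat) : set R := [set x | n%:R < `|x|].
have mtail n : measurable (tail n).
  have := @normr_measurable R setT measurableT _ (measurable_itv `]n%:R, +oo[).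
  by rewrite setTI set_itvoy.
have tail_cvg0 : G \o tail @ \oo --> G (\bigcap_n tail n).
  apply: nonincreasing_cvg_mu => //.
  - by rewrite (le_lt_trans (probability_le1 _ _))// ltry.
  - exact: bigcapT_measurable.
  - by move=> m n mn; apply/subsetPset => x /=; apply: le_lt_trans; rewrite ler_nat.
have tail0 : \bigcap_n tail n = set0.
  apply/seteqP; split => // x /(_ (Num.truncn `|x|).+1 I) /=.
  by rewrite /tail /= ltNge ltW// truncnS_gt.
rewrite tail0 measure0 in tail_cvg0.
have [n _ tail_lt] : \forall n \near \oo, (G (tail n) < eps%:E)%E.
  by apply: (tail_cvg0 [set y | (y < eps%:E)%E]); apply: open_ereal_lt'.
by exists n%:R => //; apply: ltW; exact: (tail_lt n (leqnn n)).
Qed.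

Section IntegrableTimes.
Variables (R : realType) (G : probability R R) (mu : probability (env R) R).
Hypothesis mu_iid : iid_law G mu.

(* The column is crossed at the first height [j] with a weight at most [M], and the
   events that this height exceeds [k] are geometrically unlikely. *)
Lemma cross_Lfun : @cross R \in Lfun mu 1.
Proof.
have [M M_ge0 tail_le] : exists2 M : R, 0 <= M & (G [set x | (M < `|x|)%R] <= (2^-1)%:E)%E.
  by apply: exists_norm_tail_le; rewrite invr_gt0.
set B := [set x | _] in tail_le; have mB : measurable B.
  have := @normr_measurable R setT measurableT _ (measurable_itv `]M, +oo[).
  by rewrite setTI set_itvoy.
pose column k : seq pt := [seq (0, i%:Z) | i <- index_iota 0 k.+1].
have column_uniq k : uniq (column k) by rewrite map_inj_uniq ?iota_uniq// => i j -[].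
apply: (@Lfun1_stopping _ _ _ mu _ (fun k => cylinder (column k) (fun=> B)) 2 M) => //.
- exact: measurable_time.
- by move=> k; exact: measurable_cylinder.
- have half_ge0 k : 0 <= 1 / (2 ^ k.+1)%:R :> R by rewrite divr_ge0.
  apply: le_lt_trans (ltry 1); apply: le_trans (epsilon_trick0 xpredT ler01).
  apply: lee_nneseries => // k _; rewrite mu_iid// big_map.
  elim: k.+1 => [|m ih]; first by rewrite big_geq// expn0 divr1.
  rewrite big_nat_recr//=; apply: le_trans (lee_pmul _ _ ih tail_le) _ => //.
    exact: prode_ge0.
  by rewrite -EFinM lee_fin expnS natrM invfM mulrCA mulrC.
move=> f; rewrite ger0_norm; last exact: time_ge0.
have [light|no_light] := pselect (exists j : nat, `|f (0, j%:Z)| <= M).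
  exists (ex_minn light); case: ex_minnP => j light_j j_min.
    by apply: le_trans (cross_le j f) _; rewrite lerD2r.
  move=> k kj e /mapP[i]; rewrite mem_index_iota => i_le ->.
  by rewrite /B /= ltNge; apply/negP => /j_min; lia.
exists (Num.truncn (cross f)).+1.
  by have := truncnS_gt (cross f); have := time_ge0 `[0, 1] (0, 0) (1, 0) f; lra.
move=> k _ e /mapP[i _ ->]; rewrite /B /= ltNge; apply/negP => light.
by apply: no_light; exists i.
Qed.

Lemma time_Lfun (I : interval int) (u w : pt) :
  u.1 \in I -> w.1 \in I -> u.1 <= w.1 -> time I u w \in Lfun mu 1.
Proof.
case: u w => [x y] [x' y'] /= xI x'I xx'.
have [n x'E] : exists n : nat, x' = x + n%:Z by exists `|x' - x|%N; lia.
have cross_shift (i : nat) : (fun f => cross (shift_env (x + i%:Z, y) f)) \in Lfun mu 1.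
  exact: (Lfun1_shift_env mu_iid _ cross_Lfun).
apply: Lfun1_dominated (Lfun1D (Lfun1_sum n cross_shift) (Lfun1_cst mu `|y' - y|%:~R)) _.
  exact: measurable_time.
by move=> f; rewrite ger0_norm ?time_ge0// x'E time_le_sum_cross// -x'E.
Qed.

Lemma mean_strip_time_cvg (u w : pt) : u.1 <= w.1 ->
  (fun n : nat => mean mu (time `[u.1 - n%:Z, w.1 + n%:Z] u w)) @ \oo -->
  mean mu (time plane u w).
Proof.
move=> uw; have strip_Lfun : time `[u.1, w.1] u w \in Lfun mu 1.
  by apply: time_Lfun; rewrite ?in_itv //=; lia.
have end_in (n : nat) : u.1 \in `[u.1 - n%:Z, w.1 + n%:Z] /\ w.1 \in `[u.1 - n%:Z, w.1 + n%:Z].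
  by rewrite !in_itv /=; lia.
apply: mean_dominated_cvg strip_Lfun _ => [n|||n f].
- exact: measurable_time.
- exact: measurable_time.
- apply: aeW => f; apply/cvgrPdist_le => eps eps_gt0.
  have [p /path_in_strip[n0 p_strip] cost_p] : reaches plane (fun e => `|f e|) u w
    (time plane u w f + eps) by exact: restricted_time_near.
  exists n0 => // n /= n0n; have [uI wI] := end_in n.
  have : time plane u w f <= time `[u.1 - n%:Z, w.1 + n%:Z] u w f by exact: time_sub.
  have : time `[u.1 - n%:Z, w.1 + n%:Z] u w f <= time plane u w f + eps.
    by apply: restricted_time_le => //; exists p => //; exact: p_strip.
  by rewrite distrC ler_distl; lra.
rewrite ger0_norm ?time_ge0//; apply: time_sub; rewrite ?in_itv /=; [|lia..].
by move=> x; rewrite !in_itv /=; lia.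
Qed.

End IntegrableTimes.

(** * The speed and its convexity *)

Lemma ceilD_dist (R : realType) (z x y : R) :
  (`|Num.ceil z - (Num.ceil x + Num.ceil y)|%:~R : R) <= `|z - x - y| + 2.
Proof.
rewrite intr_norm intrB intrD.
have := ceil_itv x; have := ceil_itv y; have := ceil_itv z; rewrite !intrB.
have := ler_norm (z - x - y); have := ler_norm (- (z - x - y)); rewrite normrN ler_norml.
by move=> ? ? /andP[? ?] /andP[? ?] /andP[? ?]; apply/andP; split; lra.
Qed.

Lemma ceil_residue_dist (R : realType) (v : R) (M k r : nat) : (r <= M)%N ->
  (`|Num.ceil (v * (r + k * M)%:R) - Num.ceil (v * M%:R) *+ k|%:~R : R) <=
  k%:R + (`|v| * M%:R + 1).
Proof.
move=> rM; rewrite intr_norm intrB raddfMn /= -[_ *+ k]mulr_natr natrD natrM.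
have := ceil_itv (v * (r%:R + k%:R * M%:R)); have := ceil_itv (v * M%:R); rewrite !intrB.
move: (Num.ceil _)%:~R (Num.ceil _)%:~R => cM cn /andP[cM_lt cM_ge] /andP[cn_lt cn_ge].
have k_ge0 : 0 <= k%:R :> R by [].
have vr_le : `|v * r%:R| <= `|v| * M%:R by rewrite normrM normr_nat ler_wpM2l// ler_nat.
move: vr_le; rewrite !ler_norml; move: (`|v| * M%:R) => vM /andP[vr_ge vr_le].
have := ler_wpM2r k_ge0 cM_ge.
have := ler_wpM2r k_ge0 (ltW cM_lt).
by move=> *; apply/andP; split; lra.
Qed.

Section Target.
Variable R : realType.
Implicit Types (a b v : R) (f : env R).

Definition target v (n : nat) : pt := (n%:Z, Num.ceil (v * n%:R)).

Lemma target0 v : target v 0 = 0.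
Proof. by rewrite /target mulr0 ceil0. Qed.

Lemma time_shift_plane w z f : time plane 0 w (shift_env z f) = time plane z (z + w) f.
Proof. by rewrite (@time_shift _ plane plane)// add0r (addrC w). Qed.

Lemma time_target_le a b v (k l : nat) f :
  time plane (target a k) (target v (k + l)) f <=
  time plane 0 (target b l) (shift_env (target a k) f) +
  (`|v * (k + l)%:R - a * k%:R - b * l%:R| + 2).
Proof.
rewrite time_shift_plane.
pose y := Num.ceil (a * k%:R) + Num.ceil (b * l%:R).
have -> : target a k + target b l = ((k + l)%N%:Z, y) by rewrite /target PoszD.
apply: le_trans (@time_vert_end _ plane (target a k) (k + l)%N y _ f isT isT) _.
by rewrite lerD2l; exact: ceilD_dist.
Qed.

Lemma time_target_stationary v (i n : nat) f : time plane (target v i) (target v (i + n)) f <=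
  time plane 0 (target v n) (shift_env (target v i) f) + 2.
Proof.
apply: le_trans (time_target_le v v v i n f) _.
rewrite lerD2l (_ : _ - _ - _ = 0) ?normr0 ?add0r//.
by rewrite natrD; ring.
Qed.

Lemma time_le_orbit_sum z (X : env R -> R) (k : nat) u f : (forall g, time plane 0 z g <= X g) ->
  time plane u (u + z *+ k) f <= orbit_sum z X 0 k (shift_env u f).
Proof.
move=> time_le; elim: k => [|k ih].
  by rewrite addr0 time_refl// /orbit_sum big_geq.
rewrite /orbit_sum big_nat_recr//=.
apply: le_trans (@time_triangle _ plane (u + z *+ k) _ _ f isT isT isT) (lerD ih _).
rewrite shift_env_comp (addrC _ u) mulrSr addrA -time_shift_plane; exact: time_le.
Qed.

End Target.

Section Speed.
Variables (R : realType) (G : probability R R) (mu : probability (env R) R).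
Implicit Types (a b v : R) (n : nat).

Definition mean_time v n : R := mean mu (time plane 0 (target v n)).

(* The additive constant 2 absorbs the rounding of heights: [mean_time v + 2] is
   subadditive. *)
Definition speed v : R :=
  inf [set (mean_time v n + 2) / n%:R | n in [set n | (0 < n)%N]].

Lemma mean_time_ge0 v n : 0 <= mean_time v n.
Proof. by apply: mean_ge0 => f; exact: time_ge0. Qed.

Lemma speed_ge0 v : 0 <= speed v.
Proof.
apply: lb_le_inf; first by exists ((mean_time v 1 + 2) / 1), 1%N.
by move=> _ [n _ <-]; rewrite divr_ge0 ?addr_ge0 ?mean_time_ge0.
Qed.

Lemma speed_le_mean_time v n : speed v * n%:R <= mean_time v n + 2.
Proof.
have [->|n_gt0] := posnP n; first by rewrite mulr0 addr_ge0 ?mean_time_ge0.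
rewrite -ler_pdivlMr ?ltr0n//; apply: ge_inf; last by exists n.
by exists 0 => _ [k _ <-]; rewrite divr_ge0 ?addr_ge0 ?mean_time_ge0.
Qed.

Lemma rate_opp_mean_time v : rate_le (fun n => - mean_time v n) (- speed v).
Proof.
move=> e e_gt0; exists 2 => n; have := speed_le_mean_time v n.
have : 0 <= e * n%:R by rewrite mulr_ge0// ltW.
by rewrite mulrDl; lra.
Qed.

Hypothesis mu_iid : iid_law G mu.

Lemma target_time_Lfun v n : time plane 0 (target v n) \in Lfun mu 1.
Proof. exact: (time_Lfun mu_iid). Qed.

Lemma mean_time_concat a b v (k l : nat) : mean_time v (k + l) <=
  mean_time a k + mean_time b l + (`|v * (k + l)%:R - a * k%:R - b * l%:R| + 2).
Proof.
have shift_Lfun := Lfun1_shift_env mu_iid (target a k) (target_time_Lfun b l).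
have sum_Lfun := Lfun1D (target_time_Lfun a k) shift_Lfun.
rewrite /mean_time -(mean_shift_env mu_iid (target a k) (target_time_Lfun b l)).
rewrite -(meanD (target_time_Lfun a k) shift_Lfun).
set c := _ + 2; rewrite -[X in _ <= _ + X](mean_cst mu c) -(meanD sum_Lfun (Lfun1_cst mu c)).
apply: le_mean; [exact: target_time_Lfun|exact: Lfun1D sum_Lfun (Lfun1_cst mu c)|move=> f].
apply: le_trans (@time_triangle _ plane (target a k) 0 (target v (k + l)) f isT isT isT) _.
by rewrite -addrA lerD2l; exact: time_target_le.
Qed.

Lemma rate_mean_time v : rate_le (mean_time v) (speed v).
Proof.
have subadd n m : mean_time v (n + m) + 2 <= mean_time v n + 2 + (mean_time v m + 2).
  rewrite addrACA addrA lerD2r; apply: le_trans (mean_time_concat v v v n m) _.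
  by rewrite (_ : _ - _ - _ = 0) ?normr0 ?add0r// natrD; ring.
have shifted_ge0 n : 0 <= mean_time v n + 2 by rewrite addr_ge0 ?mean_time_ge0.
move=> e e_gt0; have [b mean_le] := fekete_rate_le shifted_ge0 subadd e_gt0.
by exists b => n; apply: le_trans (mean_le n); rewrite lerDl.
Qed.

Lemma speed_convex : convex_on_nonneg speed.
Proof.
move=> a b t _ _ /andP[t_ge0 t_le1]; set v := t * a + (1 - t) * b.
apply/ler_addgt0Pr => e e_gt0.
have [ba mean_a_le] := rate_mean_time a e_gt0; have [bb mean_b_le] := rate_mean_time b e_gt0.
apply: (@le_of_linear _ _ _ (ba + bb + `|speed a - speed b| + (`|a - b| + 4))) => n.
have tn_ge0 : 0 <= t * n%:R by rewrite mulr_ge0.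
pose k := Num.truncn (t * n%:R).
have k_le : k%:R <= t * n%:R by rewrite truncn_le.
have k_gt : t * n%:R < k%:R + 1 by rewrite natr1 truncnS_gt.
have kn : (k <= n)%N by rewrite -(ler_nat R) (le_trans k_le)// ler_piMl.
have := mean_time_concat a b v k (n - k); rewrite subnKC// natrB//.
have -> : v * n%:R - a * k%:R - b * (n%:R - k%:R) = (a - b) * (t * n%:R - k%:R).
  by rewrite /v; ring.
have rounding (x : R) : `|x * (t * n%:R - k%:R)| <= `|x|.
  by rewrite normrM ler_piMr// ger0_norm ?subr_ge0// lerBlDl ltW.
have := le_trans (ler_norm _) (rounding (- (speed a - speed b))); rewrite normrN.
have := rounding (a - b).
have := speed_le_mean_time v n; have := mean_a_le k; have := mean_b_le (n - k)%N.
rewrite natrB//; move: (speed a) (speed b) (speed v) => sa sb sv.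
have -> : (t * sa + (1 - t) * sb + e) * n%:R =
  (sa + e) * k%:R + (sb + e) * (n%:R - k%:R) + (sa - sb) * (t * n%:R - k%:R) by ring.
rewrite mulNr; lra.
Qed.

(** * Almost sure bounds *)

Lemma ae_rate_opp_time v :
  {ae mu, forall f, rate_le (fun n => - time plane 0 (target v n) f) (- speed v)}.
Proof.
have := @ae_rate_le_superadditive _ _ _ mu_iid (target v)
  (fun i j f => - time plane (target v i) (target v j) f) 2; rewrite target0; apply.
- by move=> i j k f _; rewrite -opprD lerN2; exact: time_triangle.
- by move=> i f; rewrite time_refl// oppr0.
- by move=> i n f; have := time_target_stationary v i n f; lra.
- by move=> n; exact: Lfun1N (target_time_Lfun v n).
- move=> e f; exists `|f e| => n; rewrite -opprD normrN.
  exact: (@time_zero_edge _ plane e 0 (target v n) f isT isT).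
- move=> e e_gt0; have [b mean_le] := rate_opp_mean_time v e_gt0.
  by exists b => n; rewrite meanN; [exact: mean_le|exact: target_time_Lfun].
Qed.

Lemma ae_strip_sum_rate (M N : nat) v : (0 < M)%N ->
  let X := time `[- N%:Z, M%:Z + N%:Z] 0 (target v M) in
  {ae mu, forall f, rate_le (fun k => orbit_sum (target v M) X 0 k f) (mean mu X)}.
Proof.
move=> M_gt0; apply: (one_sided_strong_law mu_iid) => [|e f].
  by apply: (time_Lfun mu_iid); rewrite ?in_itv //=; lia.
exact: strip_time_local.
Qed.

Lemma exists_strip_mean_le v (M : nat) : exists N : nat,
  mean mu (time `[- N%:Z, M%:Z + N%:Z] 0 (target v M)) <= mean_time v M + 1.
Proof.
have /cvgrPdist_le/(_ _ ltr01)[N _ /(_ N (leqnn N))] :=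
  @mean_strip_time_cvg _ _ _ mu_iid 0 (target v M) isT.
by rewrite /= sub0r distrC ler_distl => /andP[_ mean_le]; exists N; exact: mean_le.
Qed.

(* For [n = r + k M] the [r] spare columns are crossed before the [k] blocks, so each
   residue [r] needs only one almost sure bound. *)
Lemma ae_time_le_block v (M : nat) : (0 < M)%N -> {ae mu, forall f,
  le_line (fun n => time plane 0 (target v n) f) ((mean_time v M + 3) / M%:R)}.
Proof.
move=> M_gt0; have [N mean_le] := exists_strip_mean_le v M.
set X := time `[- N%:Z, M%:Z + N%:Z] 0 (target v M) in mean_le.
have time_le g : time plane 0 (target v M) g <= X g.
  by apply: time_sub; rewrite ?in_itv //=; lia.
have sums_ae : {ae mu, forall f, forall r : nat, rate_le (fun k =>
    orbit_sum (target v M) X 0 k (shift_env (r%:Z, 0) f)) (mean mu X)}.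
  by apply: ae_foralln => r; exact: ae_shift_env mu_iid (ae_strip_sum_rate N v M_gt0).
apply: filterS sums_ae => f sums_rate.
have /choice[b sum_le] : forall r : nat, exists b, forall k,
    orbit_sum (target v M) X 0 k (shift_env (r%:Z, 0) f) <= (mean_time v M + 2) * k%:R + b.
  move=> r; have [b sum_le] := sums_rate r 1 ltr01; exists b => k.
  by apply: le_trans (sum_le k) _; rewrite lerD2r ler_wpM2r//; lra.
pose start r := time plane 0 (r%:Z, 0) f + b r + (`|v| * M%:R + 1).
exists (\sum_(r < M) `|start r|) => n.
have [k [r [rM ->]]] : exists k r, (r < M)%N /\ n = (r + k * M)%N.
  by exists (n %/ M)%N, (n %% M)%N; rewrite ltn_pmod// addnC -divn_eq.
have k_le : (mean_time v M + 3) * k%:R <=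
    (mean_time v M + 3) / M%:R * (r + k * M)%:R.
  rewrite -mulrA ler_wpM2l ?addr_ge0 ?mean_time_ge0// mulrC ler_pdivlMr ?ltr0n//.
  by rewrite -natrM ler_nat leq_addl.
have start_le : start r <= \sum_(r < M) `|start r|.
  by apply: le_trans (ler_norm _) _; rewrite (bigD1 (Ordinal rM))//= lerDl sumr_ge0.
have corner : (r%:Z, 0) + target v M *+ k =
    ((r + k * M)%N%:Z, Num.ceil (v * M%:R) *+ k).
  by rewrite pair_mulrn /target; congr pair; rewrite /= ?add0r// -mulr_natr natz; lia.
have := @time_vert_end _ plane 0 (r + k * M)%N%:Z (Num.ceil (v * M%:R) *+ k)
  (Num.ceil (v * (r + k * M)%:R)) f isT isT.
have := @time_triangle _ plane (r%:Z, 0) 0 ((r + k * M)%N%:Z, Num.ceil (v * M%:R) *+ k) f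
  isT isT isT.
have := time_le_orbit_sum k (r%:Z, 0) f time_le; rewrite corner.
have := sum_le r k; have := ceil_residue_dist v k (ltnW rM).
by move: start_le k_le; rewrite /start -/(target v _); lra.
Qed.

Lemma ae_rate_time v : {ae mu, forall f, rate_le (fun n => time plane 0 (target v n) f) (speed v)}.
Proof.
apply: ae_rate_le_of_lines => e e_gt0.
have half_gt0 : 0 < e / 2 by rewrite divr_gt0.
have [b mean_le] := rate_mean_time v half_gt0.
have [M b_lt] := archimedean_mulr (Num.max b 0 + 3) half_gt0.
have [max_ge0 b_le] : 0 <= Num.max b 0 /\ b <= Num.max b 0 by rewrite !le_max !lexx orbT.
have M_gt0 : (0 < M)%N.
  by rewrite lt0n; apply/eqP => M0; move: b_lt; rewrite M0 mulr0; lra.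
apply: filterS (ae_time_le_block v M_gt0) => f; apply: le_line_slope.
by rewrite ler_pdivrMr ?ltr0n//; have := mean_le M; lra.
Qed.

Theorem time_cvg_ae v :
  {ae mu, forall f, (fun n => time plane 0 (target v n) f / n%:R) @ \oo --> speed v}.
Proof.
apply: filterS2 (ae_rate_time v) (ae_rate_opp_time v) => f upper lower.
exact: rate_cvg upper lower.
Qed.

Lemma mean_time_cvg v : (fun n => mean_time v n / n%:R) @ \oo --> speed v.
Proof. exact: rate_cvg (rate_mean_time v) (rate_opp_mean_time v). Qed.

Theorem time_cvg_L1 v :
  (fun n => mean mu (fun f => `|time plane 0 (target v n) f / n%:R - speed v|)) @ \oo -->
  (0 : R).
Proof.
have divE n : (fun f => time plane 0 (target v n) f / n%:R) =
    fun f => n%:R^-1 * time plane 0 (target v n) f.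
  by apply/funext => f; rewrite mulrC.
apply: scheffe (time_cvg_ae v) _ => [n||n f|].
- by rewrite divE; exact: Lfun1Z (target_time_Lfun v n).
- exact: Lfun1_cst.
- by rewrite divr_ge0//; exact: time_ge0.
- rewrite mean_cst; under eq_fun do rewrite divE meanZ ?target_time_Lfun// mulrC.
  exact: mean_time_cvg.
Qed.

End Speed.

(** * Transfer to an arbitrary model *)

Section Model.
Variables (R : realType) (G : probability R R).
Hypothesis G_ge0 : G [set x : R | 0 <= x] = 1%E.
Context d (Omega : measurableType d) (P : probability Omega R) (tau : pt -> Omega -> R).
Hypothesis mtau : forall e, measurable_fun setT (tau e).
Hypothesis tau_law : forall e A, measurable A -> P (tau e @^-1` A) = G A.
Hypothesis tau_indep : mutually_independent P tau.

Definition env_of (w : Omega) : env R := tau ^~ w.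

Lemma measurable_env_of : measurable_fun setT env_of.
Proof. by apply: measurable_env => e; exact: mtau. Qed.

HB.instance Definition _ := isMeasurableFun.Build _ _ _ _ env_of measurable_env_of.

Definition model_law : probability (env R) R := distribution P env_of.

Lemma model_law_iid : iid_law G model_law.
Proof.
move=> s A s_uniq mA; rewrite -[LHS]/(P (env_of @^-1` cylinder s A)).
rewrite (_ : _ @^-1` _ = \bigcap_(e in [set` s]) (tau e @^-1` A e)); last first.
  by apply/seteqP; split => w tauA e /=; exact: tauA.
by rewrite tau_indep//; apply: eq_bigr => e _; exact: tau_law.
Qed.

Lemma ae_tau_ge0 : {ae P, forall w, forall e, 0 <= tau e w}.
Proof.
have m_ge0 : measurable [set x : R | 0 <= x] by rewrite -set_itvcy; exact: measurable_itv.
have tau_ge0 e : {ae P, forall w, 0 <= tau e w}.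
  have m_tau_ge0 : measurable (tau e @^-1` [set x | 0 <= x]).
    by rewrite -[X in measurable X]setTI; exact: mtau.
  exists (~` (tau e @^-1` [set x | 0 <= x])); split => //; first exact: measurableC.
  by rewrite [LHS]probability_setC// [X in (_ - X)%E]tau_law// [X in (_ - X)%E]G_ge0 subee.
have all_ge0 : {ae P, forall w, forall n : nat,
    if unpickle n is Some e then 0 <= tau (e : pt) w else true}.
  by apply: ae_foralln => n; case: unpickle => [e|]; [exact: tau_ge0|exact: aeW].
by apply: filterS all_ge0 => w all_ge0 e; have := all_ge0 (pickle e); rewrite pickleK.
Qed.

Definition model_time (v : R) n w : R := passage_time (tau ^~ w) 0 (target v n) / n%:R.

Lemma ae_model_timeE v : {ae P, forall w, forall n,
  model_time v n w = time plane 0 (target v n) (env_of w) / n%:R}.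
Proof.
apply: filterS ae_tau_ge0 => w tau_ge0 n; rewrite /model_time passage_timeE /time.
by congr (restricted_time _ _ _ _ / _); apply/funext => e; rewrite /env_of ger0_norm.
Qed.

Lemma model_time_cvg_ae v :
  {ae P, forall w, model_time v ^~ w @ \oo --> speed model_law v}.
Proof.
have [N [mN N0 env_cvg]] := time_cvg_ae model_law_iid v.
have env_of_cvg : {ae P, forall w,
    (fun n => time plane 0 (target v n) (env_of w) / n%:R) @ \oo --> speed model_law v}.
  exists (env_of @^-1` N); split => //; last by move=> w no_cvg; apply: env_cvg.
  by rewrite -[X in measurable X]setTI; exact: measurable_env_of.
apply: filterS2 env_of_cvg (ae_model_timeE v) => w w_cvg timeE.
by under eq_fun do rewrite timeE.
Qed.

Lemma integral_model_dev v c n : (\int[P]_w (`|model_time v n w - c|)%:E)%E =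
  (mean model_law (fun f => `|time plane 0 (target v n) f / n%:R - c|))%:E.
Proof.
pose dev f : R := `|time plane 0 (target v n) f / n%:R - c|.
have dev_Lfun : dev \in Lfun model_law 1.
  have scaled_Lfun := Lfun1Z n%:R^-1 (target_time_Lfun model_law_iid v n).
  have := Lfun_norm (Lfun1D scaled_Lfun (Lfun1_cst model_law (- c))).
  by rewrite (_ : _ \o _ = dev)//; apply/funext => f; rewrite /dev /= mulrC.
rewrite -(mean_distribution dev_Lfun) -integral_mean; last exact: Lfun1_distribution.
apply: ae_eq_integral => //.
- apply/measurable_EFinP; apply: measurableT_comp => //; apply: measurable_funB => //.
  apply: measurable_funM => //; under eq_fun do rewrite passage_timeE.
  exact: measurable_restricted_time.
- by apply/measurable_EFinP; exact: Lfun1_measurable (Lfun1_distribution dev_Lfun).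
- by apply: filterS (ae_model_timeE v) => w timeE _; rewrite timeE.
Qed.

Lemma model_time_cvg_L1 v :
  (fun n => \int[P]_w (`|model_time v n w - speed model_law v|)%:E)%E @ \oo --> (0 : R)%:E.
Proof.
under eq_fun do rewrite integral_model_dev.
by apply: cvg_EFin; [exact: nearW|exact: time_cvg_L1 model_law_iid v].
Qed.

End Model.

Lemma speed_unique (R : realType) (G : probability R R) (mu mu' : probability (env R) R) :
  iid_law G mu -> iid_law G mu' -> speed mu = speed mu'.
Proof.
move=> mu_iid mu'_iid; apply/funext => v; rewrite /speed /mean_time.
congr inf; apply: eq_imagel => n _; congr ((_ + _) / _).
by apply: eq_measure_mean => A; exact: (iid_law_unique mu_iid mu'_iid).
Qed.

Unset Implicit Arguments.

Theorem theorem1p1 (R : realType) (G : probability R R)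
  (HG : G [set x : R | 0 <= x] = 1%E) :
  exists Lambda : R -> R,
    (forall v, 0 <= v -> 0 <= Lambda v) /\ convex_on_nonneg Lambda /\
    forall (d : measure_display) (Omega : measurableType d)
      (P : probability Omega R) (tau : pt -> Omega -> R),
      (forall e, measurable_fun setT (tau e)) ->
      (forall e A, measurable A -> P (tau e @^-1` A) = G A) ->
      mutually_independent P tau ->
      forall v : R, 0 <= v ->
        let Tn := fun (n : nat) (w : Omega) =>
          passage_time (fun e => tau e w) (0%Z, 0%Z)
            (n%:Z, Num.ceil (v * n%:R)) / n%:R in
        {ae P, forall w, (Tn ^~ w) @ \oo --> Lambda v} /\
        ((fun n : nat => (\int[P]_w (`|Tn n w - Lambda v|)%:E)%E) @ \oo --> (0:R)%:E).
Proof.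
(* If no law on environments is i.i.d. with marginal G, then there is no model either. *)
have [[mu mu_iid]|no_iid] := pselect (exists mu : probability (env R) R, iid_law G mu).
  exists (speed mu); split; [|split].
  - by move=> v _; exact: speed_ge0.
  - exact: speed_convex mu_iid.
  - move=> d Omega P tau mtau tau_law tau_indep v _.
    have law_iid := model_law_iid mtau tau_law tau_indep.
    rewrite (speed_unique mu_iid law_iid); split.
      exact: (model_time_cvg_ae HG mtau tau_law tau_indep).
    exact: (model_time_cvg_L1 HG mtau tau_law tau_indep).
exists (fun=> 0); split => //; split; first by move=> a b t _ _ _; rewrite !mulr0 addr0.
move=> d Omega P tau mtau tau_law tau_indep; exfalso; apply: no_iid.
by exists (model_law P mtau); exact: model_law_iid.
Qed.
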